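(* Let $\tau$ be a primitive type. Suppose $$\emptyset \mid \emptyset \vdash e : \forall\, \mathsf{auth}, \mathsf{m} : \star\Rightarrow\star.\ \mathrm{AuthentikitFunc}\ \mathsf{auth}\ \mathsf{m} \to \mathsf{m}\ \tau .$$ Then for every proof $p$ (a list of strings) and every $i \in I$, if $$\langle \mathrm{run}_V\ (e\ \_\ \_\ \mathrm{Authentikit}_V)\ p,\ (\emptyset,\emptyset,i)\rangle \to_{cf}^{*} \langle \mathsf{Some}\ v, \sigma_1\rangle$$ then there exists a state $\sigma_2$ with $$\langle \mathrm{run}_I\ (e\ \_\ \_\ \mathrm{Authentikit}_I),\ (\emptyset,\emptyset,i)\rangle \to^{*} \langle v, \sigma_2\rangle.$$
   Context: $F^{\omega}_{\mu,\mathrm{ref}}$ is a call-by-value language with higher-order references and an $F^\omega$-style type system: kinds $\star$ and $\kappa_1\Rightarrow\kappa_2$; types built from variables, type-level $\lambda$, application, and constructors $\mathbf{1},\mathbf{bool},\mathbf{int},\mathbf{string},\times,+,\to,\mathbf{ref},\forall_\kappa,\exists_\kappa,\mu_\kappa$ (iso-recursive); terms are untyped ($\Lambda e$, $e\ \_$ for type abstraction/application, pack/unpack, fold/unfold) and include a primitive $\mathsf{hash}: \mathbf{string}\to\mathbf{string}$. Typing $\Theta\mid\Gamma\vdash e:\tau$ is standard with type equivalence ($\beta\eta$). $\mathsf{None}/\mathsf{Some}$ denote the two injections of $\mathbf{1}+\tau$. Hash functions $(\mathrm{hash}_i)_{i\in I}$; states $(m,h,i)$ with heap $m$, hash history $h$,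 index $i$; $\mathsf{hash}\ s$ steps to $\mathrm{hash}_i(s)$ and adds $s$ to $h$. $\to_{cf}$ is a step whose resulting state has no two distinct strings in its history with equal $\mathrm{hash}_i$; $\to_{cf}^*$, $\to^*$ are reflexive-transitive closures. A primitive type is $\mathbf{1},\mathbf{bool},\mathbf{int},\mathbf{string}$, or $\tau_1\times\tau_2$, $\tau_1+\tau_2$ with $\tau_1,\tau_2$ primitive. $\mathrm{AuthentikitFunc} := \lambda\,\mathsf{auth},\mathsf{m}:\star\Rightarrow\star.\ (\forall\alpha.\alpha\to\mathsf{m}\,\alpha)\times(\forall\alpha,\beta.\ \mathsf{m}\,\alpha\to(\alpha\to\mathsf{m}\,\beta)\to\mathsf{m}\,\beta)\times \mathrm{Authenticatable}$, where $\mathrm{Authenticatable} := \exists\,\mathsf{evi}:\star\Rightarrow\star.\ (\forall\alpha.\mathsf{evi}(\mathsf{auth}\,\alpha))\times(\forall\alpha,\beta.\mathsf{evi}\,\alpha\to\mathsf{evi}\,\beta\to\mathsf{evi}(\alpha\times\beta))\times(\forall\alpha,\beta.\mathsf{evi}\,\alpha\to\mathsf{evi}\,\beta\to\mathsf{evi}(\alpha+\beta))\times \mathsf{evi}\,\mathbf{string}\times\mathsf{evi}\,\mathbf{int}\times(\forall f:\star\Rightarrow\star.\ \mathsf{evi}(f(\mu_\star f))\to\mathsf{evi}(\mu_\star f))\times(\forall\alpha.\mathsf{evi}\,\alpha\to\alpha\to\mathsf{auth}\,\alpha)\times(\forall\alpha.\mathsf{evi}\,\alpha\to\mathsf{auth}\,\alpha\to\mathsf{m}\,\alpha)$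 (components: return, bind, then evidence for auth/pair/sum/string/int/recursive types, then $\mathrm{auth}$ and $\mathrm{unauth}$). $\mathrm{Authentikit}_I$ (ideal): $\mathsf{auth}\,\alpha=\alpha$, $\mathsf{m}\,\alpha=\mathbf{1}\to\alpha$; $\mathrm{return}\ a\ ()=a$; $\mathrm{bind}\ c\ f\ ()=f\,(c\,())\,()$; $\mathrm{auth}\ \_\ a=a$; $\mathrm{unauth}\ \_\ a\ ()=a$; $\mathrm{run}_I\ c=c\,()$. $\mathrm{Authentikit}_V$ (verifier): proofs are lists of strings; $\mathsf{auth}\,\alpha=\mathbf{string}$; $\mathsf{m}\,\alpha=\mathrm{proof}\to\mathbf{1}+(\mathrm{proof}\times\alpha)$; $\mathrm{return}\ a\ p=\mathsf{Some}(p,a)$; $\mathrm{bind}\ c\ f\ p$ returns $\mathsf{None}$ if $c\,p=\mathsf{None}$ and $f\,a\,p'$ if $c\,p=\mathsf{Some}(p',a)$; evidence for a type is a pair (serializer to string, deserializer from string to option), built by combinators following a fixed serialization scheme (the serialization of an authenticated value is its hash string) such that serializations are injective and independent of the type used, and deserialization inverts serialization; $\mathrm{auth}\ evi\ a=\mathsf{hash}(\mathrm{serialize}\ a)$; $\mathrm{unauth}\ evi\ h\ p$: if $p=s::ps$ and $\mathsf{hash}\,s=h$ then return $\mathsf{Some}(ps,a)$ if $\mathrm{deserialize}\ s=\mathsf{Some}\,a$ and $\mathsf{None}$ otherwise; in all other cases $\mathsf{None}$; $\mathrm{run}_V\ c\ p$ returns $\mathsf{Some}\,a$ if $c\,p=\mathsf{Some}(\_,a)$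 and $\mathsf{None}$ otherwise. *)

(* Defs.v *)
From Stdlib Require Import String ZArith List Relations DecimalString.
Import ListNotations.
Open Scope string_scope.

Inductive kind : Type :=
| KStar : kind
| KArrow : kind -> kind -> kind.

Inductive tconst : Type :=
| CUnit | CBool | CInt | CString
| CProd | CSum | CArrow | CRef
| CForall (k : kind) | CExists (k : kind) | CMu (k : kind).

Inductive ty : Type :=
| TVar : nat -> ty
| TLam : kind -> ty -> ty
| TApp : ty -> ty -> ty
| TC : tconst -> ty.

Definition tconst_kind (c : tconst) : kind :=
  match c with
  | CUnit | CBool | CInt | CString => KStar
  | CProd | CSum | CArrow => KArrow KStar (KArrow KStar KStar)
  | CRef => KArrow KStar KStar
  | CForall k | CExists k => KArrow (KArrow k KStar) KStar
  | CMu k => KArrow (KArrow k k) k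
  end.

Definition tunit := TC CUnit.
Definition tbool := TC CBool.
Definition tint := TC CInt.
Definition tstring := TC CString.
Definition tprod (a b : ty) := TApp (TApp (TC CProd) a) b.
Definition tsum (a b : ty) := TApp (TApp (TC CSum) a) b.
Definition tarrow (a b : ty) := TApp (TApp (TC CArrow) a) b.
Definition tref (a : ty) := TApp (TC CRef) a.
Definition tforall (k : kind) (t : ty) := TApp (TC (CForall k)) (TLam k t).
Definition texists (k : kind) (t : ty) := TApp (TC (CExists k)) (TLam k t).
Definition tmu (k : kind) (F : ty) := TApp (TC (CMu k)) F.

Fixpoint tapps (t : ty) (args : list ty) : ty :=
  match args with
  | [] => t
  | a :: r => tapps (TApp t a) r
  end.

Fixpoint tlift (d c : nat) (t : ty) : ty :=
  match t with
  | TVar n => if Nat.leb c n then TVar (n + d) else TVar n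
  | TLam k b => TLam k (tlift d (S c) b)
  | TApp a b => TApp (tlift d c a) (tlift d c b)
  | TC k => TC k
  end.

Fixpoint tsubst (j : nat) (s : ty) (t : ty) : ty :=
  match t with
  | TVar n =>
      if Nat.eqb n j then s
      else if Nat.ltb j n then TVar (n - 1) else TVar n
  | TLam k b => TLam k (tsubst (S j) (tlift 1 0 s) b)
  | TApp a b => TApp (tsubst j s a) (tsubst j s b)
  | TC k => TC k
  end.

Inductive tstep : ty -> ty -> Prop :=
| TS_beta k b s : tstep (TApp (TLam k b) s) (tsubst 0 s b)
| TS_eta k t : tstep (TLam k (TApp (tlift 1 0 t) (TVar 0))) t
| TS_lam k b b' : tstep b b' -> tstep (TLam k b) (TLam k b')
| TS_appl a a' b : tstep a a' -> tstep (TApp a b) (TApp a' b)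
| TS_appr a b b' : tstep b b' -> tstep (TApp a b) (TApp a b').

Definition ty_equiv : ty -> ty -> Prop := clos_refl_sym_trans ty tstep.

Inductive kinded : list kind -> ty -> kind -> Prop :=
| K_Var Th n k : nth_error Th n = Some k -> kinded Th (TVar n) k
| K_Lam Th k1 k2 b : kinded (k1 :: Th) b k2 -> kinded Th (TLam k1 b) (KArrow k1 k2)
| K_App Th a b k1 k2 :
    kinded Th a (KArrow k1 k2) -> kinded Th b k1 -> kinded Th (TApp a b) k2
| K_Const Th c : kinded Th (TC c) (tconst_kind c).

Inductive primitive_ty : ty -> Prop :=
| Prim_unit : primitive_ty tunit
| Prim_bool : primitive_ty tbool
| Prim_int : primitive_ty tint
| Prim_string : primitive_ty tstring
| Prim_prod a b : primitive_ty a -> primitive_ty b -> primitive_ty (tprod a b)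
| Prim_sum a b : primitive_ty a -> primitive_ty b -> primitive_ty (tsum a b).

Inductive lit : Type :=
| LBool : bool -> lit
| LInt : Z -> lit
| LStr : string -> lit.

Inductive un_op : Type :=
| NotOp | NegOp | StrLenOp | IntToStrOp | StrToIntOp.

Inductive bin_op : Type :=
| PlusOp | MinusOp | MultOp | LtOp | LeOp | EqOp
| ConcatOp
| TakeOp
| DropOp.

Inductive expr : Type :=
| Var : string -> expr
| Rec : string -> string -> expr -> expr
| App : expr -> expr -> expr
| Unit : expr
| Lit : lit -> expr
| UnOp : un_op -> expr -> expr
| BinOp : bin_op -> expr -> expr -> expr
| If : expr -> expr -> expr -> expr
| Pair : expr -> expr -> expr
| Fst : expr -> expr
| Snd : expr -> expr
| InjL : expr -> expr
| InjR : expr -> expr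
| Case : expr -> string -> expr -> string -> expr -> expr
| TAbs : expr -> expr
| TInst : expr -> expr
| Pack : expr -> expr
| Unpack : expr -> string -> expr -> expr
| Fold : expr -> expr
| Unfold : expr -> expr
| Alloc : expr -> expr
| Deref : expr -> expr
| Store : expr -> expr -> expr
| Loc : nat -> expr
| Hash : expr -> expr.

Inductive is_val : expr -> Prop :=
| V_Rec f x e : is_val (Rec f x e)
| V_Unit : is_val Unit
| V_Lit l : is_val (Lit l)
| V_Pair v1 v2 : is_val v1 -> is_val v2 -> is_val (Pair v1 v2)
| V_InjL v : is_val v -> is_val (InjL v)
| V_InjR v : is_val v -> is_val (InjR v)
| V_TAbs e : is_val (TAbs e)
| V_Pack v : is_val v -> is_val (Pack v)
| V_Fold v : is_val v -> is_val (Fold v)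
| V_Loc l : is_val (Loc l).

(* substitution of a (closed) value for a variable *)
Fixpoint subst (y : string) (w : expr) (e : expr) : expr :=
  match e with
  | Var x => if String.eqb x y then w else Var x
  | Rec f x b =>
      if orb (String.eqb f y) (String.eqb x y) then Rec f x b else Rec f x (subst y w b)
  | App a b => App (subst y w a) (subst y w b)
  | Unit => Unit
  | Lit l => Lit l
  | UnOp op a => UnOp op (subst y w a)
  | BinOp op a b => BinOp op (subst y w a) (subst y w b)
  | If a b c => If (subst y w a) (subst y w b) (subst y w c)
  | Pair a b => Pair (subst y w a) (subst y w b)
  | Fst a => Fst (subst y w a)
  | Snd a => Snd (subst y w a)
  | InjL a => InjL (subst y w a)
  | InjR a => InjR (subst y w a)
  | Case a x1 b1 x2 b2 =>
      Case (subst y w a) x1 (if String.eqb x1 y then b1 else subst y w b1)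
                         x2 (if String.eqb x2 y then b2 else subst y w b2)
  | TAbs a => TAbs (subst y w a)
  | TInst a => TInst (subst y w a)
  | Pack a => Pack (subst y w a)
  | Unpack a x b => Unpack (subst y w a) x (if String.eqb x y then b else subst y w b)
  | Fold a => Fold (subst y w a)
  | Unfold a => Unfold (subst y w a)
  | Alloc a => Alloc (subst y w a)
  | Deref a => Deref (subst y w a)
  | Store a b => Store (subst y w a) (subst y w b)
  | Loc l => Loc l
  | Hash a => Hash (subst y w a)
  end.

Definition int_to_string (z : Z) : string := NilEmpty.string_of_int (Z.to_int z).
Definition string_to_int (s : string) : option Z :=
  option_map Z.of_int (NilEmpty.int_of_string s).

Definition str_take (n : Z) (s : string) : string := substring 0 (Z.to_nat n) s.
Definition str_drop (n : Z) (s : string) : string :=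
  substring (Z.to_nat n) (String.length s) s.

Definition lit_eqb (a b : lit) : bool :=
  match a, b with
  | LBool x, LBool y => Bool.eqb x y
  | LInt x, LInt y => Z.eqb x y
  | LStr x, LStr y => String.eqb x y
  | _, _ => false
  end.

Definition un_op_eval (op : un_op) (v : expr) : option expr :=
  match op, v with
  | NotOp, Lit (LBool b) => Some (Lit (LBool (negb b)))
  | NegOp, Lit (LInt z) => Some (Lit (LInt (- z)))
  | StrLenOp, Lit (LStr s) => Some (Lit (LInt (Z.of_nat (String.length s))))
  | IntToStrOp, Lit (LInt z) => Some (Lit (LStr (int_to_string z)))
  | StrToIntOp, Lit (LStr s) =>
      Some (match string_to_int s with
            | None => InjL Unit
            | Some z => InjR (Lit (LInt z))
            end)
  | _, _ => None
  end.

Definition bin_op_eval (op : bin_op) (v1 v2 : expr) : option expr :=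
  match op, v1, v2 with
  | PlusOp, Lit (LInt a), Lit (LInt b) => Some (Lit (LInt (a + b)))
  | MinusOp, Lit (LInt a), Lit (LInt b) => Some (Lit (LInt (a - b)))
  | MultOp, Lit (LInt a), Lit (LInt b) => Some (Lit (LInt (a * b)))
  | LtOp, Lit (LInt a), Lit (LInt b) => Some (Lit (LBool (Z.ltb a b)))
  | LeOp, Lit (LInt a), Lit (LInt b) => Some (Lit (LBool (Z.leb a b)))
  | EqOp, Lit a, Lit b => Some (Lit (LBool (lit_eqb a b)))
  | ConcatOp, Lit (LStr a), Lit (LStr b) => Some (Lit (LStr (a ++ b)))
  | TakeOp, Lit (LStr s), Lit (LInt n) => Some (Lit (LStr (str_take n s)))
  | DropOp, Lit (LStr s), Lit (LInt n) => Some (Lit (LStr (str_drop n s)))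
  | _, _, _ => None
  end.

Definition tctx := list (string * ty).

Fixpoint lookup (G : tctx) (x : string) : option ty :=
  match G with
  | [] => None
  | (y, t) :: G' => if String.eqb x y then Some t else lookup G' x
  end.

Definition lift_ctx (G : tctx) : tctx := map (fun p => (fst p, tlift 1 0 (snd p))) G.

Inductive un_op_typed : un_op -> ty -> ty -> Prop :=
| UT_Not : un_op_typed NotOp tbool tbool
| UT_Neg : un_op_typed NegOp tint tint
| UT_StrLen : un_op_typed StrLenOp tstring tint
| UT_IntToStr : un_op_typed IntToStrOp tint tstring
| UT_StrToInt : un_op_typed StrToIntOp tstring (tsum tunit tint).

Inductive bin_op_typed : bin_op -> ty -> ty -> ty -> Prop :=
| BT_Plus : bin_op_typed PlusOp tint tint tint
| BT_Minus : bin_op_typed MinusOp tint tint tint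
| BT_Mult : bin_op_typed MultOp tint tint tint
| BT_Lt : bin_op_typed LtOp tint tint tbool
| BT_Le : bin_op_typed LeOp tint tint tbool
| BT_EqBool : bin_op_typed EqOp tbool tbool tbool
| BT_EqInt : bin_op_typed EqOp tint tint tbool
| BT_EqStr : bin_op_typed EqOp tstring tstring tbool
| BT_Concat : bin_op_typed ConcatOp tstring tstring tstring
| BT_Take : bin_op_typed TakeOp tstring tint tstring
| BT_Drop : bin_op_typed DropOp tstring tint tstring.

Inductive typed : list kind -> tctx -> expr -> ty -> Prop :=
| T_Var Th G x t : lookup G x = Some t -> typed Th G (Var x) t
| T_Unit Th G : typed Th G Unit tunit
| T_Bool Th G b : typed Th G (Lit (LBool b)) tbool
| T_Int Th G z : typed Th G (Lit (LInt z)) tint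
| T_Str Th G s : typed Th G (Lit (LStr s)) tstring
| T_Rec Th G f x e t1 t2 :
    kinded Th t1 KStar -> kinded Th t2 KStar ->
    typed Th ((x, t1) :: (f, tarrow t1 t2) :: G) e t2 ->
    typed Th G (Rec f x e) (tarrow t1 t2)
| T_App Th G e1 e2 t1 t2 :
    typed Th G e1 (tarrow t1 t2) -> typed Th G e2 t1 -> typed Th G (App e1 e2) t2
| T_UnOp Th G op e t1 t :
    un_op_typed op t1 t -> typed Th G e t1 -> typed Th G (UnOp op e) t
| T_BinOp Th G op e1 e2 t1 t2 t :
    bin_op_typed op t1 t2 t -> typed Th G e1 t1 -> typed Th G e2 t2 ->
    typed Th G (BinOp op e1 e2) t
| T_If Th G e e1 e2 t :
    typed Th G e tbool -> typed Th G e1 t -> typed Th G e2 t -> typed Th G (If e e1 e2) t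
| T_Pair Th G e1 e2 t1 t2 :
    typed Th G e1 t1 -> typed Th G e2 t2 -> typed Th G (Pair e1 e2) (tprod t1 t2)
| T_Fst Th G e t1 t2 : typed Th G e (tprod t1 t2) -> typed Th G (Fst e) t1
| T_Snd Th G e t1 t2 : typed Th G e (tprod t1 t2) -> typed Th G (Snd e) t2
| T_InjL Th G e t1 t2 :
    kinded Th t2 KStar -> typed Th G e t1 -> typed Th G (InjL e) (tsum t1 t2)
| T_InjR Th G e t1 t2 :
    kinded Th t1 KStar -> typed Th G e t2 -> typed Th G (InjR e) (tsum t1 t2)
| T_Case Th G e x1 e1 x2 e2 t1 t2 t :
    typed Th G e (tsum t1 t2) ->
    typed Th ((x1, t1) :: G) e1 t -> typed Th ((x2, t2) :: G) e2 t ->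
    typed Th G (Case e x1 e1 x2 e2) t
| T_TAbs Th G e k t :
    typed (k :: Th) (lift_ctx G) e t -> typed Th G (TAbs e) (tforall k t)
| T_TInst Th G e k T s :
    typed Th G e (TApp (TC (CForall k)) T) -> kinded Th s k ->
    typed Th G (TInst e) (TApp T s)
| T_Pack Th G e k T s :
    kinded Th T (KArrow k KStar) -> kinded Th s k -> typed Th G e (TApp T s) ->
    typed Th G (Pack e) (TApp (TC (CExists k)) T)
| T_Unpack Th G e x e2 k T t :
    typed Th G e (TApp (TC (CExists k)) T) ->
    typed (k :: Th) ((x, TApp (tlift 1 0 T) (TVar 0)) :: lift_ctx G) e2 (tlift 1 0 t) ->
    kinded Th t KStar ->
    typed Th G (Unpack e x e2) t
| T_Fold Th G e k F args :
    kinded Th F (KArrow k k) -> kinded Th (tapps (tmu k F) args) KStar ->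
    typed Th G e (tapps (TApp F (tmu k F)) args) ->
    typed Th G (Fold e) (tapps (tmu k F) args)
| T_Unfold Th G e k F args :
    typed Th G e (tapps (tmu k F) args) ->
    typed Th G (Unfold e) (tapps (TApp F (tmu k F)) args)
| T_Alloc Th G e t : typed Th G e t -> typed Th G (Alloc e) (tref t)
| T_Deref Th G e t : typed Th G e (tref t) -> typed Th G (Deref e) t
| T_Store Th G e1 e2 t :
    typed Th G e1 (tref t) -> typed Th G e2 t -> typed Th G (Store e1 e2) tunit
| T_Hash Th G e : typed Th G e tstring -> typed Th G (Hash e) tstring
| T_Conv Th G e t t' :
    typed Th G e t -> ty_equiv t t' -> kinded Th t' KStar -> typed Th G e t'.

Record state (I : Type) : Type := mkState {
  st_heap : nat -> option expr;
  st_hist : list string;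
  st_idx : I
}.
Arguments mkState {I} _ _ _.
Arguments st_heap {I} _ _.
Arguments st_hist {I} _.
Arguments st_idx {I} _.

Definition init_state {I : Type} (i : I) : state I := mkState (fun _ => None) [] i.

Definition heap_upd (m : nat -> option expr) (l : nat) (v : expr) : nat -> option expr :=
  fun l' => if Nat.eqb l' l then Some v else m l'.

Section Semantics.
Context {I : Type} (hashf : I -> string -> string).

Inductive head_step : expr -> state I -> expr -> state I -> Prop :=
| HS_Beta f x e v s :
    is_val v -> head_step (App (Rec f x e) v) s (subst f (Rec f x e) (subst x v e)) s
| HS_UnOp op v v' s : is_val v -> un_op_eval op v = Some v' -> head_step (UnOp op v) s v' s
| HS_BinOp op v1 v2 v' s :
    is_val v1 -> is_val v2 -> bin_op_eval op v1 v2 = Some v' ->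
    head_step (BinOp op v1 v2) s v' s
| HS_IfTrue e1 e2 s : head_step (If (Lit (LBool true)) e1 e2) s e1 s
| HS_IfFalse e1 e2 s : head_step (If (Lit (LBool false)) e1 e2) s e2 s
| HS_Fst v1 v2 s : is_val v1 -> is_val v2 -> head_step (Fst (Pair v1 v2)) s v1 s
| HS_Snd v1 v2 s : is_val v1 -> is_val v2 -> head_step (Snd (Pair v1 v2)) s v2 s
| HS_CaseL v x1 e1 x2 e2 s :
    is_val v -> head_step (Case (InjL v) x1 e1 x2 e2) s (subst x1 v e1) s
| HS_CaseR v x1 e1 x2 e2 s :
    is_val v -> head_step (Case (InjR v) x1 e1 x2 e2) s (subst x2 v e2) s
| HS_TInst e s : head_step (TInst (TAbs e)) s e s
| HS_Unpack v x e s : is_val v -> head_step (Unpack (Pack v) x e) s (subst x v e) s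
| HS_Unfold v s : is_val v -> head_step (Unfold (Fold v)) s v s
| HS_Alloc v m h i l :
    is_val v -> m l = None ->
    head_step (Alloc v) (mkState m h i) (Loc l) (mkState (heap_upd m l v) h i)
| HS_Deref l v s : st_heap s l = Some v -> head_step (Deref (Loc l)) s v s
| HS_Store l v w m h i :
    is_val v -> m l = Some w ->
    head_step (Store (Loc l) v) (mkState m h i) Unit (mkState (heap_upd m l v) h i)
| HS_Hash str m h i :
    head_step (Hash (Lit (LStr str))) (mkState m h i)
              (Lit (LStr (hashf i str))) (mkState m (str :: h) i).

Inductive ectx_item : Type :=
| AppLCtx (e2 : expr) | AppRCtx (v1 : expr)
| UnOpCtx (op : un_op) | BinOpLCtx (op : bin_op) (e2 : expr) | BinOpRCtx (op : bin_op) (v1 : expr)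
| IfCtx (e1 e2 : expr)
| PairLCtx (e2 : expr) | PairRCtx (v1 : expr)
| FstCtx | SndCtx | InjLCtx | InjRCtx
| CaseCtx (x1 : string) (e1 : expr) (x2 : string) (e2 : expr)
| TInstCtx | PackCtx | UnpackCtx (x : string) (e2 : expr)
| FoldCtx | UnfoldCtx | AllocCtx | DerefCtx
| StoreLCtx (e2 : expr) | StoreRCtx (v1 : expr) | HashCtx.

Definition fill_item (K : ectx_item) (e : expr) : expr :=
  match K with
  | AppLCtx e2 => App e e2
  | AppRCtx v1 => App v1 e
  | UnOpCtx op => UnOp op e
  | BinOpLCtx op e2 => BinOp op e e2
  | BinOpRCtx op v1 => BinOp op v1 e
  | IfCtx e1 e2 => If e e1 e2
  | PairLCtx e2 => Pair e e2
  | PairRCtx v1 => Pair v1 e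
  | FstCtx => Fst e
  | SndCtx => Snd e
  | InjLCtx => InjL e
  | InjRCtx => InjR e
  | CaseCtx x1 e1 x2 e2 => Case e x1 e1 x2 e2
  | TInstCtx => TInst e
  | PackCtx => Pack e
  | UnpackCtx x e2 => Unpack e x e2
  | FoldCtx => Fold e
  | UnfoldCtx => Unfold e
  | AllocCtx => Alloc e
  | DerefCtx => Deref e
  | StoreLCtx e2 => Store e e2
  | StoreRCtx v1 => Store v1 e
  | HashCtx => Hash e
  end.

Definition item_ok (K : ectx_item) : Prop :=
  match K with
  | AppRCtx v1 | BinOpRCtx _ v1 | PairRCtx v1 | StoreRCtx v1 => is_val v1
  | _ => True
  end.

Inductive prim_step : expr -> state I -> expr -> state I -> Prop :=
| PS_head e s e' s' : head_step e s e' s' -> prim_step e s e' s'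
| PS_ctx K e s e' s' :
    item_ok K -> prim_step e s e' s' -> prim_step (fill_item K e) s (fill_item K e') s'.

Definition config := (expr * state I)%type.

Definition step (c c' : config) : Prop := prim_step (fst c) (snd c) (fst c') (snd c').

Definition collision_free (s : state I) : Prop :=
  forall s1 s2, In s1 (st_hist s) -> In s2 (st_hist s) -> s1 <> s2 ->
    hashf (st_idx s) s1 <> hashf (st_idx s) s2.

Definition cf_step (c c' : config) : Prop := step c c' /\ collision_free (snd c').

Definition steps : config -> config -> Prop := clos_refl_trans_1n config step.
Definition cf_steps : config -> config -> Prop := clos_refl_trans_1n config cf_step.

End Semantics.

Definition V := TVar.
Definition KF := KArrow KStar KStar.

(* body of Authenticatable, under the binder evi (evi = 0, m = 1, auth = 2) *)
Definition authenticatable_body : ty :=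
  tprod (tforall KStar (TApp (V 1) (TApp (V 3) (V 0))))                     (* evi (auth a) *)
 (tprod (tforall KStar (tforall KStar
           (tarrow (TApp (V 2) (V 1)) (tarrow (TApp (V 2) (V 0))
                   (TApp (V 2) (tprod (V 1) (V 0)))))))                     (* pair *)
 (tprod (tforall KStar (tforall KStar
           (tarrow (TApp (V 2) (V 1)) (tarrow (TApp (V 2) (V 0))
                   (TApp (V 2) (tsum (V 1) (V 0)))))))                      (* sum *)
 (tprod (TApp (V 0) tstring)
 (tprod (TApp (V 0) tint)
 (tprod (tforall KF (tarrow (TApp (V 1) (TApp (V 0) (tmu KStar (V 0))))
                            (TApp (V 1) (tmu KStar (V 0)))))                (* mu *)
 (tprod (tforall KStar (tarrow (TApp (V 1) (V 0)) (tarrow (V 0) (TApp (V 3) (V 0)))))  (* auth *)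
        (tforall KStar (tarrow (TApp (V 1) (V 0))
                               (tarrow (TApp (V 3) (V 0)) (TApp (V 2) (V 0))))))))))). (* unauth *)

(* Authenticatable, with auth = 1, m = 0 *)
Definition authenticatable : ty := texists KF authenticatable_body.

(* AuthentikitFunc := lambda auth m : * => *. return x bind x Authenticatable *)
Definition AuthentikitFunc : ty :=
  TLam KF (TLam KF
    (tprod (tforall KStar (tarrow (V 0) (TApp (V 1) (V 0))))
    (tprod (tforall KStar (tforall KStar
              (tarrow (TApp (V 2) (V 1))
                 (tarrow (tarrow (V 1) (TApp (V 2) (V 0))) (TApp (V 2) (V 0))))))
           authenticatable))).

Definition client_ty (tau : ty) : ty :=
  tforall KF (tforall KF
    (tarrow (TApp (TApp AuthentikitFunc (V 1)) (V 0)) (TApp (V 0) (tlift 2 0 tau)))).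

Definition Lam (x : string) (e : expr) : expr := Rec "" x e.
Definition Let (x : string) (e1 e2 : expr) : expr := App (Lam x e2) e1.
Definition App2 (f a b : expr) : expr := App (App f a) b.
Definition ENone : expr := InjL Unit.
Definition ESome (e : expr) : expr := InjR e.
Definition MatchOpt (e en : expr) (x : string) (es : expr) : expr := Case e "_" en x es.
Definition Str (s : string) : expr := Lit (LStr s).
Definition Int (z : Z) : expr := Lit (LInt z).
Definition EqE (a b : expr) := BinOp EqOp a b.
Definition Cat (a b : expr) := BinOp ConcatOp a b.
Definition Take (s n : expr) := BinOp TakeOp s n.
Definition Drop (s n : expr) := BinOp DropOp s n.

Definition returnI := TAbs (Lam "a" (Lam "u" (Var "a"))).
Definition bindI :=
  TAbs (TAbs (Lam "c" (Lam "f" (Lam "u" (App2 (Var "f") (App (Var "c") Unit) Unit))))).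
Definition authI := TAbs (Lam "evi" (Lam "a" (Var "a"))).
Definition unauthI := TAbs (Lam "evi" (Lam "a" (Lam "u" (Var "a")))).

(* evidence is trivial in the ideal implementation: evi a = 1 *)
Definition AuthentikitI : expr :=
  Pair returnI (Pair bindI (Pack
    (Pair (TAbs Unit)
    (Pair (TAbs (TAbs (Lam "e1" (Lam "e2" Unit))))
    (Pair (TAbs (TAbs (Lam "e1" (Lam "e2" Unit))))
    (Pair Unit
    (Pair Unit
    (Pair (TAbs (Lam "e" Unit))
    (Pair authI unauthI))))))))).

Definition runI : expr := Lam "c" (App (Var "c") Unit).

(* Serialization scheme (on values, independent of the type):
     string s   ~>  "s" ++ decimal(length s) ++ ":" ++ s
     int n      ~>  "i" ++ decimal(n) ++ ";"
     (v1, v2)   ~>  "p" ++ ser v1 ++ ser v2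
     inl v      ~>  "l" ++ ser v
     inr v      ~>  "r" ++ ser v
     fold v     ~>  ser v
     auth value (a hash string h) ~> ser of the string h.
   Evidence for a type a is a pair (serializer : a -> string,
   deserializer : string -> 1 + (a * string)); the deserializer parses a
   prefix and returns the unconsumed rest; a complete deserialization
   requires the rest to be empty. *)

Definition find_ch (c : string) : expr :=
  Rec "find" "s" (Lam "k"
    (If (BinOp LeOp (UnOp StrLenOp (Var "s")) (Var "k"))
        (Int (-1))
        (If (EqE (Take (Drop (Var "s") (Var "k")) (Int 1)) (Str c))
            (Var "k")
            (App2 (Var "find") (Var "s") (BinOp PlusOp (Var "k") (Int 1)))))).

Definition ser_str : expr :=
  Lam "v" (Cat (Str "s") (Cat (UnOp IntToStrOp (UnOp StrLenOp (Var "v")))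
                              (Cat (Str ":") (Var "v")))).

Definition parse_str : expr :=
  Lam "s" (If (EqE (Take (Var "s") (Int 1)) (Str "s"))
    (Let "r" (Drop (Var "s") (Int 1))
    (Let "k" (App2 (find_ch ":") (Var "r") (Int 0))
    (If (BinOp LtOp (Var "k") (Int 0)) ENone
    (MatchOpt (UnOp StrToIntOp (Take (Var "r") (Var "k"))) ENone "n"
    (Let "b" (Drop (Var "r") (BinOp PlusOp (Var "k") (Int 1)))
    (If (BinOp LtOp (Var "n") (Int 0)) ENone
    (If (BinOp LtOp (UnOp StrLenOp (Var "b")) (Var "n")) ENone
        (ESome (Pair (Take (Var "b") (Var "n")) (Drop (Var "b") (Var "n")))))))))))
    ENone).

Definition ser_int : expr :=
  Lam "v" (Cat (Str "i") (Cat (UnOp IntToStrOp (Var "v")) (Str ";"))).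

Definition parse_int : expr :=
  Lam "s" (If (EqE (Take (Var "s") (Int 1)) (Str "i"))
    (Let "r" (Drop (Var "s") (Int 1))
    (Let "k" (App2 (find_ch ";") (Var "r") (Int 0))
    (If (BinOp LtOp (Var "k") (Int 0)) ENone
    (MatchOpt (UnOp StrToIntOp (Take (Var "r") (Var "k"))) ENone "n"
       (ESome (Pair (Var "n") (Drop (Var "r") (BinOp PlusOp (Var "k") (Int 1)))))))))
    ENone).

Definition evi_stringV : expr := Pair ser_str parse_str.
Definition evi_intV : expr := Pair ser_int parse_int.
Definition evi_authV : expr := TAbs evi_stringV.

Definition evi_pairV : expr :=
  TAbs (TAbs (Lam "e1" (Lam "e2" (Pair
    (Lam "v" (Cat (Str "p") (Cat (App (Fst (Var "e1")) (Fst (Var "v")))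
                                 (App (Fst (Var "e2")) (Snd (Var "v"))))))
    (Lam "s" (If (EqE (Take (Var "s") (Int 1)) (Str "p"))
       (MatchOpt (App (Snd (Var "e1")) (Drop (Var "s") (Int 1))) ENone "r1"
       (MatchOpt (App (Snd (Var "e2")) (Snd (Var "r1"))) ENone "r2"
          (ESome (Pair (Pair (Fst (Var "r1")) (Fst (Var "r2"))) (Snd (Var "r2"))))))
       ENone)))))).

Definition evi_sumV : expr :=
  TAbs (TAbs (Lam "e1" (Lam "e2" (Pair
    (Lam "v" (Case (Var "v")
                "a" (Cat (Str "l") (App (Fst (Var "e1")) (Var "a")))
                "b" (Cat (Str "r") (App (Fst (Var "e2")) (Var "b")))))
    (Lam "s" (Let "t" (Take (Var "s") (Int 1))
       (If (EqE (Var "t") (Str "l"))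
          (MatchOpt (App (Snd (Var "e1")) (Drop (Var "s") (Int 1))) ENone "r"
             (ESome (Pair (InjL (Fst (Var "r"))) (Snd (Var "r")))))
       (If (EqE (Var "t") (Str "r"))
          (MatchOpt (App (Snd (Var "e2")) (Drop (Var "s") (Int 1))) ENone "r"
             (ESome (Pair (InjR (Fst (Var "r"))) (Snd (Var "r")))))
          ENone)))))))).

Definition evi_muV : expr :=
  TAbs (Lam "e" (Pair
    (Lam "v" (App (Fst (Var "e")) (Unfold (Var "v"))))
    (Lam "s" (MatchOpt (App (Snd (Var "e")) (Var "s")) ENone "r"
                (ESome (Pair (Fold (Fst (Var "r"))) (Snd (Var "r")))))))).

Definition returnV : expr :=
  TAbs (Lam "a" (Lam "p" (ESome (Pair (Var "p") (Var "a"))))).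

Definition bindV : expr :=
  TAbs (TAbs (Lam "c" (Lam "f" (Lam "p"
    (MatchOpt (App (Var "c") (Var "p")) ENone "r"
       (App2 (Var "f") (Snd (Var "r")) (Fst (Var "r")))))))).

Definition authV : expr :=
  TAbs (Lam "evi" (Lam "a" (Hash (App (Fst (Var "evi")) (Var "a"))))).

(* proofs: list string = mu l. 1 + string * l *)
Definition unauthV : expr :=
  TAbs (Lam "evi" (Lam "h" (Lam "p"
    (Case (Unfold (Var "p"))
       "_" ENone
       "c" (Let "s" (Fst (Var "c"))
             (If (EqE (Hash (Var "s")) (Var "h"))
                (MatchOpt (App (Snd (Var "evi")) (Var "s")) ENone "r"
                   (If (EqE (Snd (Var "r")) (Str ""))
                       (ESome (Pair (Snd (Var "c")) (Fst (Var "r"))))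
                       ENone))
                ENone)))))).

Definition AuthentikitV : expr :=
  Pair returnV (Pair bindV (Pack
    (Pair evi_authV
    (Pair evi_pairV
    (Pair evi_sumV
    (Pair evi_stringV
    (Pair evi_intV
    (Pair evi_muV
    (Pair authV unauthV))))))))).

Definition runV : expr :=
  Lam "c" (Lam "p" (MatchOpt (App (Var "c") (Var "p")) ENone "r" (ESome (Snd (Var "r"))))).

Fixpoint proof_val (p : list string) : expr :=
  match p with
  | [] => Fold (InjL Unit)
  | s :: ps => Fold (InjR (Pair (Str s) (proof_val ps)))
  end.

(* Main.v *)
Require Import Defs.
From Stdlib Require Import String List ZArith Lia Relations.
From Stdlib Require Import DecimalString DecimalZ FunctionalExtensionality Ascii.
Import ListNotations.
Open Scope string_scope.

(** The verifier run and the ideal run of the client are related by a purely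
    syntactic simulation.  [rel] is a two-sided copy of the type system in which
    the client type variables [auth], [m], [evi] have become fresh rigid type
    constants, inhabited only by values that the two libraries can
    produce; [rel] is preserved by a step of the verifier together with some
    steps of the ideal program, as in a subject-reduction proof, so that neither
    step-indexing nor recursive worlds are needed in spite of the higher-order
    store.  A hash string [h] is related to [v2] at [auth a] if [h] is the hash
    of the serialization of a value related to [v2] at [a], this serialization
    being in the history of the verifier.  When the verifier checks a proof
    element against [h], collision freedom forces it to be that serialization,
    and deserialization gives back the related value.

    Kinds play no role: runtime types are arbitrary untyped lambda terms, and
    confluence of beta-eta makes type constructors injective. *)

(** * Erased types and confluence *)

(** The world records the history because collision freedom speaks only of strings that have been
    hashed: [ser v1] enters the history when [auth] hashes it, and the check in [unauth] adds the
    candidate string, so that one state contains both.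

    Running a computation cannot be part of [rel]. There both sides advance together, whereas a
    verifier run may stop with [ENone] where the ideal program goes on. Since [m] is a rigid
    constant, the client cannot apply a computation itself; only [runV] and the code of [bind] do.
    So [rel] treats computations as inert values, and a second relation, [mrel], follows their
    execution at top level.

    The verifier leads: each of its steps is answered by finitely many ideal steps, possibly none,
    so a finite verifier run yields a finite ideal run. *)

Inductive ucon : Type := UK (c : tconst) | UAuth | UM | UEvi.

Inductive uty : Type :=
| UVar : nat -> uty
| ULam : uty -> uty
| UApp : uty -> uty -> uty
| UC : ucon -> uty.

Definition scons {A} (a : A) (f : nat -> A) (n : nat) : A :=
  match n with 0 => a | S n => f n end.

Definition upren (r : nat -> nat) : nat -> nat := scons 0 (fun n => S (r n)).

Fixpoint uren (r : nat -> nat) (t : uty) : uty :=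
  match t with
  | UVar n => UVar (r n)
  | ULam b => ULam (uren (upren r) b)
  | UApp a b => UApp (uren r a) (uren r b)
  | UC c => UC c
  end.

Definition up (s : nat -> uty) : nat -> uty := scons (UVar 0) (fun n => uren S (s n)).

Fixpoint usubst (s : nat -> uty) (t : uty) : uty :=
  match t with
  | UVar n => s n
  | ULam b => ULam (usubst (up s) b)
  | UApp a b => UApp (usubst s a) (usubst s b)
  | UC c => UC c
  end.

Definition beta (s : uty) : nat -> uty := scons s UVar.

Lemma upren_comp r1 r2 : (fun n => upren r2 (upren r1 n)) = upren (fun n => r2 (r1 n)).
Proof. extensionality n; destruct n; reflexivity. Qed.

Lemma uren_uren t : forall r1 r2, uren r2 (uren r1 t) = uren (fun n => r2 (r1 n)) t.
Proof.
  induction t; intros r1 r2; simpl; f_equal; auto.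
  rewrite IHt, upren_comp; reflexivity.
Qed.

Lemma usubst_uren t : forall r s, usubst s (uren r t) = usubst (fun n => s (r n)) t.
Proof.
  induction t; intros r s; simpl; f_equal; auto.
  rewrite IHt; f_equal; extensionality n; destruct n; reflexivity.
Qed.

Lemma uren_usubst t : forall r s, uren r (usubst s t) = usubst (fun n => uren r (s n)) t.
Proof.
  induction t; intros r s; simpl; f_equal; auto.
  rewrite IHt; f_equal; extensionality n; destruct n; simpl; auto.
  rewrite !uren_uren; reflexivity.
Qed.

Lemma usubst_usubst t : forall s1 s2,
  usubst s2 (usubst s1 t) = usubst (fun n => usubst s2 (s1 n)) t.
Proof.
  induction t; intros s1 s2; simpl; f_equal; auto.
  rewrite IHt; f_equal; extensionality n; destruct n; simpl; auto.
  rewrite usubst_uren, uren_usubst; reflexivity.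
Qed.

Lemma usubst_UVar t : usubst UVar t = t.
Proof.
  induction t; simpl; f_equal; auto.
  replace (up UVar) with UVar; auto.
  extensionality n; destruct n; reflexivity.
Qed.

Lemma usubst_shift s d t : usubst (scons s d) (uren S t) = usubst d t.
Proof. rewrite usubst_uren; reflexivity. Qed.

Lemma usubst_beta_shift s t : usubst (beta s) (uren S t) = t.
Proof. unfold beta; rewrite usubst_shift; apply usubst_UVar. Qed.

Lemma usubst_up_beta s d t : usubst (beta s) (usubst (up d) t) = usubst (scons s d) t.
Proof.
  rewrite usubst_usubst; f_equal; extensionality n; destruct n; simpl; auto.
  apply usubst_beta_shift.
Qed.

Lemma usubst_beta_comm s d t :
  usubst d (usubst (beta s) t) = usubst (beta (usubst d s)) (usubst (up d) t).
Proof.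
  rewrite usubst_up_beta, usubst_usubst; f_equal; extensionality n; destruct n; reflexivity.
Qed.

Lemma uren_S_up d t : usubst (up d) (uren S t) = uren S (usubst d t).
Proof. rewrite usubst_uren, uren_usubst; reflexivity. Qed.

Lemma uren_S_upren r t : uren (upren r) (uren S t) = uren S (uren r t).
Proof. rewrite !uren_uren; reflexivity. Qed.

Lemma uren_inj t : forall r t', (forall x y, r x = r y -> x = y) -> uren r t = uren r t' -> t = t'.
Proof.
  induction t; intros r [] Hr H; simpl in H; try discriminate; injection H; intros; f_equal; eauto.
  eapply IHt; [|eassumption].
  intros [|x] [|y]; simpl; intros E; try discriminate; auto.
Qed.

Lemma uren_S_inj t t' : uren S t = uren S t' -> t = t'.
Proof. apply uren_inj; intros x y E; injection E; auto. Qed.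

(* The hypothesis says that [f'], [g'] are a weak pullback of the renamings [f], [g]. *)
Lemma uren_pullback t : forall t' (f g f' g' : nat -> nat),
  (forall x y, f x = g y -> exists z, x = g' z /\ y = f' z) ->
  uren f t = uren g t' -> exists w, t = uren g' w /\ t' = uren f' w.
Proof.
  induction t; intros [] f g f' g' Hp E; simpl in E; try discriminate; injection E; intros.
  - destruct (Hp _ _ H) as (z & -> & ->). exists (UVar z); auto.
  - destruct (IHt u (upren f) (upren g) (upren f') (upren g')) as (w & -> & ->); auto.
    { intros [|x] [|y]; simpl; intros E'; try discriminate.
      - exists 0; auto.
      - injection E' as E'. destruct (Hp _ _ E') as (z & -> & ->). exists (S z); auto. }
    exists (ULam w); auto.
  - destruct (IHt1 _ _ _ _ _ Hp H0) as (w1 & -> & ->).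
    destruct (IHt2 _ _ _ _ _ Hp H) as (w2 & -> & ->).
    exists (UApp w1 w2); auto.
  - subst. eexists (UC _); simpl; eauto.
Qed.

Lemma uren_upren_S r t t' :
  uren (upren r) t = uren S t' -> exists w, t = uren S w /\ t' = uren r w.
Proof.
  apply uren_pullback. intros [|x] y; simpl; intros E; try discriminate.
  injection E as E; eauto.
Qed.

(** Parallel beta-eta reduction in the style of Tait and Martin-Löf: one step may contract several
    redexes at once, copies of a redex made by a beta step included, which lets the diamond close
    with one step on each side. *)
Inductive par : uty -> uty -> Prop :=
| P_Var n : par (UVar n) (UVar n)
| P_Con c : par (UC c) (UC c)
| P_Lam b b' : par b b' -> par (ULam b) (ULam b')
| P_App a a' b b' : par a a' -> par b b' -> par (UApp a b) (UApp a' b')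
| P_Beta b b' s s' : par b b' -> par s s' -> par (UApp (ULam b) s) (usubst (beta s') b')
| P_Eta t t' : par t t' -> par (ULam (UApp (uren S t) (UVar 0))) t'.

Lemma par_refl t : par t t.
Proof. induction t; constructor; auto. Qed.
#[local] Hint Resolve par_refl : core.

Lemma par_uren t t' : par t t' -> forall r, par (uren r t) (uren r t').
Proof.
  induction 1; intros r; simpl; try constructor; auto.
  - replace (uren r (usubst (beta s') b'))
      with (usubst (beta (uren r s')) (uren (upren r) b')).
    + constructor; auto.
    + rewrite usubst_uren, uren_usubst; f_equal; extensionality n; destruct n; reflexivity.
  - rewrite uren_S_upren. constructor; auto.
Qed.

Lemma par_usubst t t' : par t t' -> forall s s', (forall n, par (s n) (s' n)) ->
  par (usubst s t) (usubst s' t').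
Proof.
  assert (Hup : forall s s', (forall n, par (s n) (s' n)) -> forall n, par (up s n) (up s' n)).
  { intros s s' H [|n]; simpl; auto using par_uren. }
  induction 1; intros d d' Hd; simpl; try (constructor; auto; fail); auto.
  - rewrite usubst_beta_comm. constructor; auto.
  - rewrite uren_S_up. constructor; auto.
Qed.

Lemma par_beta b b' s s' : par b b' -> par s s' -> par (usubst (beta s) b) (usubst (beta s') b').
Proof. intros; apply par_usubst; auto. intros [|n]; simpl; auto. Qed.

(** Reduction creates no free variables. With [r] = [S] this makes the side condition of eta, that
    variable 0 does not occur, stable under reduction. *)
Lemma par_uren_inv t t' : par t t' -> forall r u, (forall x y, r x = r y -> x = y) ->
  t = uren r u -> exists u', t' = uren r u' /\ par u u'.
Proof.
  assert (Hup : forall r, (forall x y, r x = r y -> x = y) ->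
     forall x y, upren r x = upren r y -> x = y).
  { intros r Hr [|x] [|y]; simpl; intros E; try discriminate; auto. }
  induction 1; intros r u Hr E; destruct u; simpl in E; try discriminate; injection E; intros; subst.
  - eexists (UVar _); simpl; eauto.
  - eexists (UC _); simpl; eauto.
  - destruct (IHpar (upren r) u) as (u' & -> & ?); eauto.
    exists (ULam u'); split; auto; constructor; auto.
  - destruct (IHpar1 r u1) as (a & -> & ?); auto.
    destruct (IHpar2 r u2) as (c & -> & ?); auto.
    exists (UApp a c); split; auto; constructor; auto.
  - destruct u1; try discriminate. injection H2 as ->.
    destruct (IHpar1 (upren r) u1) as (a & -> & ?); eauto.
    destruct (IHpar2 r u2) as (c & -> & ?); auto.
    exists (usubst (beta c) a); split; [|constructor; auto].
    rewrite usubst_uren, uren_usubst; f_equal; extensionality n; destruct n; reflexivity.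
  - destruct u; try discriminate. injection H0 as E1 E2.
    destruct u2; try discriminate. injection E2 as E2.
    assert (n = 0) by (destruct n; simpl in E2; congruence); subst.
    symmetry in E1. destruct (uren_upren_S _ _ _ E1) as (w & -> & ->).
    destruct (IHpar r w) as (w' & -> & ?); auto.
    exists w'; split; auto. constructor; auto.
Qed.

Lemma par_uren_S_inv t t' : par (uren S t) t' -> exists u, t' = uren S u /\ par t u.
Proof. intros H; eapply par_uren_inv in H; eauto. Qed.

Fixpoint usize (t : uty) : nat :=
  match t with
  | UVar _ | UC _ => 1
  | ULam b => S (usize b)
  | UApp a b => S (usize a + usize b)
  end.

Lemma usize_uren t : forall r, usize (uren r t) = usize t.
Proof. induction t; intros; simpl; auto. Qed.

(** The overlap of eta with beta: if [u] is [ULam d], the body of the eta redex is itself a beta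
    redex, and contracting it gives back [d], because substituting variable 0 into the shifted [d]
    is the identity. *)
Lemma par_eta_body u b' : par (UApp (uren S u) (UVar 0)) b' ->
  (exists u', b' = UApp (uren S u') (UVar 0) /\ par u u') \/
  (exists d, u = ULam d /\ par d b').
Proof.
  intros H; inversion H; subst.
  - left. apply par_uren_S_inv in H2 as (u' & -> & ?). inversion H4; subst; eauto.
  - right. destruct u; try discriminate. injection H0 as ->.
    inversion H4; subst. exists u; split; auto.
    assert (Hi : forall x y, upren S x = upren S y -> x = y)
      by (intros [|x] [|y]; simpl; intros E; try discriminate; auto).
    destruct (par_uren_inv _ _ H2 _ _ Hi eq_refl) as (v & -> & Hp).
    rewrite usubst_uren. replace (fun n => _) with UVar.
    + rewrite usubst_UVar; auto.
    + extensionality n; destruct n; reflexivity.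
Qed.

(** Induction on the size rather than on the derivations: when eta meets beta, the terms to be
    joined are reducts of [ULam d] or [UApp (ULam d) s], and their reductions are rebuilt instead of
    being subderivations of the given ones. *)
Lemma par_diamond : forall n t a b, usize t < n -> par t a -> par t b ->
  exists c, par a c /\ par b c.
Proof.
  induction n as [|n IH]; intros t a b Hn Ha Hb; [lia|].
  (* The two critical situations: [eta_lam] is an eta redex whose body reduces on the other side,
     [eta_beta] an eta redex that is also the function of a beta redex. *)
  assert (eta_lam : forall u w b', usize (ULam (UApp (uren S u) (UVar 0))) < S n ->
            par u w -> par (UApp (uren S u) (UVar 0)) b' ->
            exists c, par w c /\ par (ULam b') c).
  { intros u w b' Hs Hw Hb'. simpl in Hs; rewrite usize_uren in Hs.
    destruct (par_eta_body _ _ Hb') as [(u' & -> & Hu)|(d & -> & Hd)].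
    - destruct (IH u w u') as (c & ? & ?); auto; try lia.
      exists c; split; auto; constructor; auto.
    - destruct (IH (ULam d) w (ULam b')) as (c & ? & ?); auto; try lia.
      + constructor; auto.
      + eauto. }
  assert (eta_beta : forall u w b' s s' s'',
            usize (UApp (ULam (UApp (uren S u) (UVar 0))) s) < S n ->
            par u w -> par (UApp (uren S u) (UVar 0)) b' -> par s s' -> par s s'' ->
            exists c, par (UApp w s') c /\ par (usubst (beta s'') b') c).
  { intros u w b' s s' s'' Hs Hw Hb' Hs' Hs''. simpl in Hs; rewrite usize_uren in Hs.
    destruct (par_eta_body _ _ Hb') as [(u' & -> & Hu)|(d & -> & Hd)].
    - destruct (IH u w u') as (c & ? & ?); auto; try lia.
      destruct (IH s s' s'') as (c' & ? & ?); auto; try lia.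
      simpl. rewrite usubst_beta_shift.
      exists (UApp c c'); split; constructor; auto.
    - destruct (IH (UApp (ULam d) s) (UApp w s') (usubst (beta s'') b')) as (c & ? & ?); eauto.
      + simpl in *; lia.
      + constructor; auto.
      + constructor; auto. }
  assert (and_comm_ex : forall P Q : uty -> Prop, (exists c, P c /\ Q c) -> exists c, Q c /\ P c)
    by firstorder.
  inversion Ha; subst; inversion Hb; subst; simpl in Hn.
  - eauto.
  - eauto.
  - destruct (IH b0 b' b'0) as (c & ? & ?); auto; try lia.
    exists (ULam c); split; constructor; auto.
  - apply and_comm_ex. eapply eta_lam; try eassumption; simpl; lia.
  - destruct (IH a0 a' a'0) as (c & ? & ?); auto; try lia.
    destruct (IH b0 b' b'0) as (c' & ? & ?); auto; try lia.
    exists (UApp c c'); split; constructor; auto.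
  - inversion H; subst.
    + destruct (IH b1 b'1 b'0) as (c & ? & ?); auto; try (simpl in *; lia).
      destruct (IH b0 b' s') as (c' & ? & ?); auto; try lia.
      exists (usubst (beta c') c); split; [constructor; auto|apply par_beta; auto].
    + eapply eta_beta; try eassumption; simpl; lia.
  - inversion H3; subst.
    + destruct (IH b0 b' b'1) as (c & ? & ?); auto; try (simpl in *; lia).
      destruct (IH s s' b'0) as (c' & ? & ?); auto; try lia.
      exists (usubst (beta c') c); split; [apply par_beta; auto|constructor; auto].
    + apply and_comm_ex. eapply eta_beta; try eassumption; simpl; lia.
  - destruct (IH b0 b' b'0) as (c & ? & ?); auto; try (simpl in *; lia).
    destruct (IH s s' s'0) as (c' & ? & ?); auto; try lia.
    exists (usubst (beta c') c); split; apply par_beta; auto.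
  - eapply eta_lam; try eassumption; simpl; lia.
  - match goal with E : uren S _ = uren S _ |- _ => apply uren_S_inj in E; subst end.
    rewrite usize_uren in Hn.
    eapply IH; [|eassumption..]; lia.
Qed.

Notation pars := (clos_refl_trans_1n uty par).
Notation conv := (clos_refl_sym_trans uty par).

Lemma par_strip a b c : par a b -> pars a c -> exists d, pars b d /\ par c d.
Proof.
  intros Hb Hc; revert b Hb; induction Hc; intros b Hb.
  - exists b; split; [constructor|auto].
  - destruct (par_diamond _ _ _ _ (Nat.lt_succ_diag_r _) H Hb) as (d & Hy & Hd).
    destruct (IHHc _ Hy) as (d' & ? & ?). exists d'; split; auto.
    econstructor; eauto.
Qed.

Lemma pars_trans a b c : pars a b -> pars b c -> pars a c.
Proof. induction 1; auto. intros; econstructor; eauto. Qed.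

Lemma pars_confluent a b c : pars a b -> pars a c -> exists d, pars b d /\ pars c d.
Proof.
  intros Hb; revert c; induction Hb; intros c Hc.
  - exists c; split; [auto|constructor].
  - destruct (par_strip _ _ _ H Hc) as (d & Hd & ?).
    destruct (IHHb _ Hd) as (d' & ? & ?). exists d'; split; auto.
    econstructor; eauto.
Qed.

Lemma church_rosser a b : conv a b -> exists c, pars a c /\ pars b c.
Proof.
  induction 1.
  - exists y; split; econstructor; eauto; constructor.
  - exists x; split; constructor.
  - destruct IHclos_refl_sym_trans as (c & ? & ?); eauto.
  - destruct IHclos_refl_sym_trans1 as (c & ? & ?), IHclos_refl_sym_trans2 as (d & ? & ?).
    destruct (pars_confluent y c d) as (e & ? & ?); auto.
    exists e; split; eapply pars_trans; eauto.
Qed.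

Lemma conv_refl a : conv a a. Proof. apply rst_refl. Qed.
Lemma conv_sym a b : conv a b -> conv b a. Proof. apply rst_sym. Qed.
Lemma conv_trans a b c : conv a b -> conv b c -> conv a c. Proof. apply rst_trans. Qed.

#[local] Hint Resolve conv_refl conv_sym : core.

Lemma conv_app a a' b b' : conv a a' -> conv b b' -> conv (UApp a b) (UApp a' b').
Proof.
  intros Ha Hb. apply conv_trans with (UApp a' b).
  - clear Hb. induction Ha; eauto using conv_trans. constructor; constructor; auto.
  - clear Ha. induction Hb; eauto using conv_trans. constructor; constructor; auto.
Qed.

Lemma conv_beta b s : conv (UApp (ULam b) s) (usubst (beta s) b).
Proof. constructor; constructor; auto. Qed.

Lemma conv_usubst a b d : conv a b -> conv (usubst d a) (usubst d b).
Proof.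
  induction 1; eauto using conv_trans. constructor; apply par_usubst; auto.
Qed.

Lemma conv_lam a b : conv a b -> conv (ULam a) (ULam b).
Proof. induction 1; eauto using conv_trans. constructor; constructor; auto. Qed.

(** * Head constants: disjointness and injectivity of type constructors *)

Fixpoint spine (t : uty) (args : list uty) : option (ucon * list uty) :=
  match t with
  | UC c => Some (c, args)
  | UApp a b => spine a (b :: args)
  | _ => None
  end.

Lemma par_spine t t' : par t t' -> forall args args' c l,
  spine t args = Some (c, l) -> Forall2 conv args args' ->
  exists l', spine t' args' = Some (c, l') /\ Forall2 conv l l'.
Proof.
  induction 1; intros args args' c0 l Hs Ha; simpl in *; try discriminate.
  - injection Hs as <- <-; eauto.
  - eapply IHpar1; eauto. constructor; auto. constructor; auto.
Qed.

Lemma Forall2_conv_refl l : Forall2 conv l l.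
Proof. induction l; constructor; auto. Qed.

Lemma Forall2_conv_trans l1 l2 l3 : Forall2 conv l1 l2 -> Forall2 conv l2 l3 -> Forall2 conv l1 l3.
Proof.
  intros H; revert l3; induction H; intros l3 H3; inversion H3; subst; constructor;
    eauto using conv_trans.
Qed.

Lemma Forall2_conv_sym l1 l2 : Forall2 conv l1 l2 -> Forall2 conv l2 l1.
Proof. induction 1; constructor; auto. Qed.

Lemma pars_spine t t' : pars t t' -> forall c l, spine t [] = Some (c, l) ->
  exists l', spine t' [] = Some (c, l') /\ Forall2 conv l l'.
Proof.
  induction 1; intros c l Hs; eauto using Forall2_conv_refl.
  destruct (par_spine _ _ H [] [] _ _ Hs) as (l' & Hs' & ?); [constructor|].
  destruct (IHclos_refl_trans_1n _ _ Hs') as (l'' & ? & ?); eauto using Forall2_conv_trans.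
Qed.

(** By Church-Rosser both sides have a common reduct, and reduction fixes a constant head and acts
    on its arguments only. The two conclusions are disjointness and injectivity of type
    constructors; the canonical forms of values rest on them. *)
Lemma conv_spine t t' c c' l l' : conv t t' ->
  spine t [] = Some (c, l) -> spine t' [] = Some (c', l') -> c = c' /\ Forall2 conv l l'.
Proof.
  intros H Hs Hs'. destruct (church_rosser _ _ H) as (u & H1 & H2).
  destruct (pars_spine _ _ H1 _ _ Hs) as (l1 & E1 & ?).
  destruct (pars_spine _ _ H2 _ _ Hs') as (l2 & E2 & ?).
  rewrite E1 in E2; injection E2 as <- <-.
  eauto using Forall2_conv_trans, Forall2_conv_sym.
Qed.

(** * Erasure of kind annotations *)

Fixpoint er (t : ty) : uty :=
  match t with
  | TVar n => UVar n
  | TLam _ b => ULam (er b)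
  | TApp a b => UApp (er a) (er b)
  | TC c => UC (UK c)
  end.

Lemma er_tlift t : forall d c,
  er (tlift d c t) = uren (fun n => if Nat.leb c n then n + d else n) (er t).
Proof.
  induction t; intros d c; simpl; f_equal; auto.
  - destruct (Nat.leb c n); auto.
  - rewrite IHt; f_equal; extensionality n; destruct n; simpl; auto.
    destruct (Nat.leb c n); auto.
Qed.

Lemma er_tlift_1 t : er (tlift 1 0 t) = uren S (er t).
Proof. rewrite er_tlift; f_equal; extensionality n; simpl; lia. Qed.

Lemma er_tsubst t : forall j s,
  er (tsubst j s t) =
  usubst (fun n => if Nat.eqb n j then er s else if Nat.ltb j n then UVar (n - 1) else UVar n) (er t).
Proof.
  induction t; intros j s; simpl; f_equal; auto.
  - destruct (Nat.eqb n j), (Nat.ltb j n); auto.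
  - rewrite IHt; f_equal; extensionality n; destruct n; simpl; auto.
    rewrite er_tlift_1. destruct (Nat.eqb_spec n j); auto.
    change (Nat.ltb (S j) (S n)) with (Nat.ltb j n).
    destruct (Nat.ltb_spec j n); simpl; auto. f_equal; lia.
Qed.

Lemma er_tsubst_0 s t : er (tsubst 0 s t) = usubst (beta (er s)) (er t).
Proof.
  rewrite er_tsubst; f_equal; extensionality n; destruct n; simpl; auto.
  rewrite Nat.sub_0_r; auto.
Qed.

(* [tstep] may change the kind annotation of a type-level lambda (by an eta
   expansion followed by a beta step), hence the erasure of annotations. *)
Lemma ty_equiv_conv t t' : ty_equiv t t' -> conv (er t) (er t').
Proof.
  induction 1; eauto using conv_trans.
  induction H; simpl; auto using conv_app, conv_lam.
  - rewrite er_tsubst_0; apply conv_beta.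
  - rewrite er_tlift_1. constructor; constructor; auto.
Qed.

(** * Pure evaluation *)

#[local] Hint Constructors is_val : core.
#[local] Hint Extern 1 (is_val _) => unfold Str, Int, Lam, ESome, ENone : core.

Lemma is_val_dec e : is_val e \/ ~ is_val e.
Proof.
  induction e; try (left; constructor; fail); try (right; intros H; inversion H; fail).
  all: repeat match goal with H : _ \/ _ |- _ => destruct H end;
    try (left; constructor; assumption); right; intros H'; inversion H'; auto.
Qed.

Lemma val_no_step {I} (hashf : I -> string -> string) e s e' s' :
  prim_step hashf e s e' s' -> is_val e -> False.
Proof.
  induction 1 as [e s e' s' H|K e s e' s' Hok H IH]; intros Hv.
  - inversion H; subst; inversion Hv.
  - destruct K; simpl in Hv; inversion Hv; subst; auto.
Qed.

Lemma fill_step_inv {I} (hashf : I -> string -> string) K e s e' s' :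
  item_ok K -> ~ is_val e -> prim_step hashf (fill_item K e) s e' s' ->
  exists e0, e' = fill_item K e0 /\ prim_step hashf e s e0 s'.
Proof.
  intros Hok Hv H. inversion H as [? ? ? ? Hh|K' e0 ? e0' ? Hok' H']; subst.
  - exfalso; apply Hv. destruct K; simpl in Hh; inversion Hh; subst; auto.
  - destruct K, K'; simpl in *; try discriminate;
      match goal with E : _ = _ |- _ => injection E; intros; subst end;
      try (eexists; split; [reflexivity|eassumption]; fail);
      exfalso; eauto using val_no_step.
Qed.

(** The head steps that neither use nor change the state: no allocation, no access to the heap, no
    hashing. Nearly all library code runs by these. *)
Inductive phead : expr -> expr -> Prop :=
| PH_Beta f x e v : is_val v -> phead (App (Rec f x e) v) (subst f (Rec f x e) (subst x v e))
| PH_UnOp op v v' : is_val v -> un_op_eval op v = Some v' -> phead (UnOp op v) v'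
| PH_BinOp op v1 v2 v' :
    is_val v1 -> is_val v2 -> bin_op_eval op v1 v2 = Some v' -> phead (BinOp op v1 v2) v'
| PH_If (b : bool) e1 e2 : phead (If (Lit (LBool b)) e1 e2) (if b then e1 else e2)
| PH_Fst v1 v2 : is_val v1 -> is_val v2 -> phead (Fst (Pair v1 v2)) v1
| PH_Snd v1 v2 : is_val v1 -> is_val v2 -> phead (Snd (Pair v1 v2)) v2
| PH_CaseL v x1 e1 x2 e2 : is_val v -> phead (Case (InjL v) x1 e1 x2 e2) (subst x1 v e1)
| PH_CaseR v x1 e1 x2 e2 : is_val v -> phead (Case (InjR v) x1 e1 x2 e2) (subst x2 v e2)
| PH_TInst e : phead (TInst (TAbs e)) e
| PH_Unpack v x e : is_val v -> phead (Unpack (Pack v) x e) (subst x v e)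
| PH_Unfold v : is_val v -> phead (Unfold (Fold v)) v.

Inductive pstep : expr -> expr -> Prop :=
| pstep_head e e' : phead e e' -> pstep e e'
| pstep_ctx K e e' : item_ok K -> pstep e e' -> pstep (fill_item K e) (fill_item K e').

Lemma pstep_prim {I} (hashf : I -> string -> string) e e' s :
  pstep e e' -> prim_step hashf e s e' s.
Proof.
  induction 1 as [e e' H|K e e' Hok H IH].
  - apply PS_head. destruct H; try (constructor; auto; fail).
    destruct b; constructor.
  - apply PS_ctx; auto.
Qed.

Ltac subval :=
  match goal with
  | H : prim_step _ ?e _ _ _ |- _ =>
      exfalso; refine (val_no_step _ _ _ _ _ H _); auto; fail
  end.

(* Inverts a step of an expression whose immediate subexpressions in
   evaluation position are values: only a head step remains. *)
Ltac inv_head H :=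
  let K := fresh "K" in let e0 := fresh "e0" in let E := fresh "E" in
  let Hh := fresh "Hh" in let H' := fresh "H'" in
  inversion H as [? ? ? ? Hh|K e0 ? ? ? ? H' E]; subst;
  [inversion Hh; subst
  |destruct K; simpl in E; try discriminate; injection E; intros; subst; subval].

(** The steps of the verifier are given, not chosen; this turns a computed pure step of library code
    into the step actually taken. *)
Lemma pstep_det {I} (hashf : I -> string -> string) e e' :
  pstep e e' -> forall s e'' s'', prim_step hashf e s e'' s'' -> e'' = e' /\ s'' = s.
Proof.
  induction 1 as [e e' H|K e e' Hok H IH]; intros s e'' s'' Hs.
  - destruct H; inv_head Hs; split; congruence.
  - apply fill_step_inv in Hs as (e0 & -> & Hs); auto.
    + destruct (IH _ _ _ Hs) as [-> ->]; auto.
    (* [val_no_step] asks for a hash function and a state; the identity, indexed by [unit], and the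
       initial state serve as dummies. *)
    + intros Hv. eapply (val_no_step (fun _ : unit => fun x => x)); [|exact Hv].
      apply (pstep_prim _ _ _ (init_state tt)); eassumption.
Qed.

Notation psteps := (clos_refl_trans_1n expr pstep).

Lemma psteps_trans a b c : psteps a b -> psteps b c -> psteps a c.
Proof. induction 1; auto. intros; econstructor; eauto. Qed.

Lemma psteps_ctx K e e' : item_ok K -> psteps e e' -> psteps (fill_item K e) (fill_item K e').
Proof. intros Hok; induction 1; econstructor; eauto. apply pstep_ctx; auto. Qed.

Lemma psteps_one e e' : phead e e' -> psteps e e'.
Proof. intros; econstructor; [apply pstep_head; eassumption|constructor]. Qed.

Lemma psteps_val v e : is_val v -> psteps v e -> e = v.
Proof.
  intros Hv H; inversion H; subst; auto.
  exfalso. eapply (val_no_step (fun _ : unit => fun x => x)); [|exact Hv].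
  apply (pstep_prim _ _ _ (init_state tt)); eassumption.
Qed.

(** Big-step form of pure evaluation, for the constructs used by serializers and parsers: their runs
    are derived along the syntax, without writing down the intermediate terms. *)
Inductive ev : expr -> expr -> Prop :=
| ev_val v : is_val v -> ev v v
| ev_app e1 e2 f x b w v :
    ev e1 (Rec f x b) -> ev e2 w -> ev (subst f (Rec f x b) (subst x w b)) v -> ev (App e1 e2) v
| ev_unop op e w v : ev e w -> un_op_eval op w = Some v -> ev (UnOp op e) v
| ev_binop op e1 e2 w1 w2 v :
    ev e1 w1 -> ev e2 w2 -> bin_op_eval op w1 w2 = Some v -> ev (BinOp op e1 e2) v
| ev_if e e1 e2 (b : bool) v : ev e (Lit (LBool b)) -> ev (if b then e1 else e2) v -> ev (If e e1 e2) v
| ev_pair e1 e2 v1 v2 : ev e1 v1 -> ev e2 v2 -> ev (Pair e1 e2) (Pair v1 v2)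
| ev_fst e v1 v2 : ev e (Pair v1 v2) -> ev (Fst e) v1
| ev_snd e v1 v2 : ev e (Pair v1 v2) -> ev (Snd e) v2
| ev_injl e v : ev e v -> ev (InjL e) (InjL v)
| ev_injr e v : ev e v -> ev (InjR e) (InjR v)
| ev_casel e x1 e1 x2 e2 w v : ev e (InjL w) -> ev (subst x1 w e1) v -> ev (Case e x1 e1 x2 e2) v
| ev_caser e x1 e1 x2 e2 w v : ev e (InjR w) -> ev (subst x2 w e2) v -> ev (Case e x1 e1 x2 e2) v
| ev_fold e v : ev e v -> ev (Fold e) (Fold v)
| ev_unfold e v : ev e (Fold v) -> ev (Unfold e) v.

Lemma un_op_eval_val op v v' : un_op_eval op v = Some v' -> is_val v'.
Proof.
  destruct op, v as [| | | |[]| | | | | | | | | | | | | | | | | | | |]; simpl; try discriminate;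
    intros E; injection E as <-; auto.
  destruct (string_to_int s); auto.
Qed.

Lemma bin_op_eval_val op v1 v2 v' : bin_op_eval op v1 v2 = Some v' -> is_val v'.
Proof.
  destruct op, v1 as [| | | |[]| | | | | | | | | | | | | | | | | | | |]; simpl; try discriminate;
  destruct v2 as [| | | |[]| | | | | | | | | | | | | | | | | | | |]; simpl; try discriminate;
  intros E; injection E as <-; auto.
Qed.

Lemma ev_is_val e v : ev e v -> is_val v.
Proof.
  induction 1; auto; eauto using un_op_eval_val, bin_op_eval_val;
    match goal with H : is_val (_ _) |- _ => inversion H; auto
                  | H : is_val (_ _ _) |- _ => inversion H; auto end.
Qed.

Ltac ctx K := eapply psteps_trans; [apply (psteps_ctx K); simpl; eauto using ev_is_val|simpl].

Lemma ev_psteps e v : ev e v -> psteps e v.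
Proof.
  induction 1.
  - constructor.
  - ctx (AppLCtx e2). ctx (AppRCtx (Rec f x b)).
    eapply psteps_trans; [apply psteps_one, PH_Beta; eauto using ev_is_val|auto].
  - ctx (UnOpCtx op). apply psteps_one, PH_UnOp; eauto using ev_is_val.
  - ctx (BinOpLCtx op e2). ctx (BinOpRCtx op w1). apply psteps_one, PH_BinOp; eauto using ev_is_val.
  - ctx (IfCtx e1 e2). eapply psteps_trans; [apply psteps_one, PH_If|auto].
  - ctx (PairLCtx e2). ctx (PairRCtx v1). constructor.
  - apply ev_is_val in H; inversion H; subst. ctx FstCtx. apply psteps_one, PH_Fst; auto.
  - apply ev_is_val in H; inversion H; subst. ctx SndCtx. apply psteps_one, PH_Snd; auto.
  - ctx InjLCtx. constructor.
  - ctx InjRCtx. constructor.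
  - apply ev_is_val in H; inversion H; subst. ctx (CaseCtx x1 e1 x2 e2).
    eapply psteps_trans; [apply psteps_one, PH_CaseL; auto|auto].
  - apply ev_is_val in H; inversion H; subst. ctx (CaseCtx x1 e1 x2 e2).
    eapply psteps_trans; [apply psteps_one, PH_CaseR; auto|auto].
  - ctx FoldCtx. constructor.
  - apply ev_is_val in H; inversion H; subst. ctx UnfoldCtx. apply psteps_one, PH_Unfold; auto.
Qed.

Lemma ev_val_inv v w : is_val v -> ev v w -> w = v.
Proof. intros Hv H; apply psteps_val; auto using ev_psteps. Qed.

(** [codec] speaks of calls on values, while the library code calls serializers and parsers on
    unevaluated projections and string operations. *)
Lemma ev_app_arg f a v r : is_val v -> ev (App f v) r -> ev a v -> ev (App f a) r.
Proof.
  intros Hv H Ha; inversion H as [? Hr| ? ? f' x b w ? Hf Hw Hb| | | | | | | | | | | | ]; subst; [inversion Hr|].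
  apply ev_val_inv in Hw; subst; auto. eapply ev_app; eauto.
Qed.

(** * Closed expressions *)

Fixpoint closedb (l : list string) (e : expr) : bool :=
  match e with
  | Var x => existsb (String.eqb x) l
  | Rec f x b => closedb (x :: f :: l) b
  | App a b | BinOp _ a b | Pair a b | Store a b => closedb l a && closedb l b
  | Unit | Lit _ | Loc _ => true
  | UnOp _ a | Fst a | Snd a | InjL a | InjR a | TAbs a | TInst a | Pack a
  | Fold a | Unfold a | Alloc a | Deref a | Hash a => closedb l a
  | If a b c => closedb l a && closedb l b && closedb l c
  | Case a x1 b1 x2 b2 => closedb l a && closedb (x1 :: l) b1 && closedb (x2 :: l) b2
  | Unpack a x b => closedb l a && closedb (x :: l) b
  end.

Lemma existsb_eqb x L : existsb (String.eqb x) L = true <-> In x L.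
Proof.
  rewrite existsb_exists; split.
  - intros (y & Hy & E). apply String.eqb_eq in E; subst; auto.
  - intros; exists x; split; auto using String.eqb_refl.
Qed.

Lemma closedb_incl e : forall L L', closedb L e = true -> incl L L' -> closedb L' e = true.
Proof.
  induction e; simpl; intros L L' Hc HL; auto;
    repeat match goal with H : (_ && _)%bool = true |- _ => apply andb_prop in H as [? ?] end;
    rewrite ?Bool.andb_true_iff; repeat split;
    try match goal with IH : forall L L', _ -> _ -> _ |- _ => eapply IH; eassumption end;
    try (match goal with IH : forall L L', _ -> _ -> closedb _ ?e = true |- closedb _ ?e = true =>
      eapply IH; [eassumption|] end; intros z; simpl; intuition; fail).
  rewrite existsb_eqb in *; auto.
Qed.

Lemma subst_closedb y w e : forall L, closedb L e = true -> ~ In y L -> subst y w e = e.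
Proof.
  induction e; simpl; intros L Hc Hy; auto;
    repeat match goal with H : (_ && _)%bool = true |- _ => apply andb_prop in H as [? ?] end;
    try (f_equal; match goal with IH : forall L, _ -> _ -> _ |- _ => eapply IH; eassumption end).
  - apply existsb_eqb in Hc. destruct (String.eqb_spec s y); subst; tauto.
  - destruct (String.eqb_spec s y), (String.eqb_spec s0 y); simpl; auto.
    f_equal. eapply IHe; eauto. simpl; intuition congruence.
  - f_equal; eauto.
    + destruct (String.eqb_spec s y); auto. eapply IHe2; eauto. simpl; intuition congruence.
    + destruct (String.eqb_spec s0 y); auto. eapply IHe3; eauto. simpl; intuition congruence.
  - f_equal; eauto.
    destruct (String.eqb_spec s y); auto. eapply IHe2; eauto. simpl; intuition congruence.
Qed.

Lemma subst_closed y w e : closedb [] e = true -> subst y w e = e.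
Proof. intros; eapply subst_closedb; eauto. Qed.

Lemma closedb_subst x v e : closedb [] v = true -> forall L L',
  closedb L e = true -> (forall z, In z L -> z = x \/ In z L') ->
  closedb L' (subst x v e) = true.
Proof.
  intros Hv; induction e; simpl; intros L L' Hc Hl; auto;
    repeat match goal with H : (_ && _)%bool = true |- _ => apply andb_prop in H as [? ?] end;
    rewrite ?Bool.andb_true_iff; repeat split;
    try match goal with IH : forall L L', _ -> _ -> _ |- _ => eapply IH; eassumption end.
  - apply existsb_eqb in Hc. destruct (String.eqb_spec s x); subst.
    + eapply closedb_incl; eauto. intros z [].
    + simpl. apply existsb_eqb. destruct (Hl s); tauto.
  - destruct (String.eqb_spec s x), (String.eqb_spec s0 x); subst; simpl;
      try (eapply closedb_incl; [eassumption|]; intros z [|[|Hz]]; simpl; auto;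
           destruct (Hl z Hz); subst; auto; fail).
    eapply IHe; [eassumption|]. intros z [|[|Hz]]; simpl; auto. destruct (Hl z Hz); auto.
  - destruct (String.eqb_spec s x); subst.
    + eapply closedb_incl; [eassumption|]. intros z [|Hz]; simpl; auto. destruct (Hl z Hz); subst; auto.
    + eapply IHe2; [eassumption|]. intros z [|Hz]; simpl; auto. destruct (Hl z Hz); auto.
  - destruct (String.eqb_spec s0 x); subst.
    + eapply closedb_incl; [eassumption|]. intros z [|Hz]; simpl; auto. destruct (Hl z Hz); subst; auto.
    + eapply IHe3; [eassumption|]. intros z [|Hz]; simpl; auto. destruct (Hl z Hz); auto.
  - destruct (String.eqb_spec s x); subst.
    + eapply closedb_incl; [eassumption|]. intros z [|Hz]; simpl; auto. destruct (Hl z Hz); subst; auto.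
    + eapply IHe2; [eassumption|]. intros z [|Hz]; simpl; auto. destruct (Hl z Hz); auto.
Qed.

Lemma phead_closed e e' : phead e e' -> closedb [] e = true -> closedb [] e' = true.
Proof.
  destruct 1; simpl; intros Hc;
    repeat match goal with H : (_ && _)%bool = true |- _ => apply andb_prop in H as [? ?] end;
    auto; try (eapply closedb_subst; eauto; simpl; intuition; fail).
  - eapply closedb_subst with (L := [f]); simpl; auto; [|intuition].
    eapply closedb_subst; eauto. simpl; intuition.
  - destruct op, v as [| | | |[]| | | | | | | | | | | | | | | | | | | |]; simpl in *;
      try discriminate; injection H0 as <-; auto. destruct (string_to_int s); auto.
  - destruct op, v1 as [| | | |[]| | | | | | | | | | | | | | | | | | | |]; simpl in *; try discriminate;
    destruct v2 as [| | | |[]| | | | | | | | | | | | | | | | | | | |]; simpl in *; try discriminate;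
    injection H1 as <-; auto.
  - destruct b; auto.
Qed.

Lemma pstep_closed e e' : pstep e e' -> closedb [] e = true -> closedb [] e' = true.
Proof.
  induction 1 as [e e' H|K e e' Hok H IH]; intros Hc; [eauto using phead_closed|].
  destruct K; simpl in *;
    repeat match goal with H : (_ && _)%bool = true |- _ => apply andb_prop in H as [? ?] end;
    rewrite ?Bool.andb_true_iff; auto.
Qed.

(** * Strings, decimals and the search for a separator *)

Lemma append_assoc a b c : (a ++ b) ++ c = a ++ (b ++ c).
Proof. induction a; simpl; f_equal; auto. Qed.

Lemma append_nil_r a : a ++ "" = a.
Proof. induction a; simpl; f_equal; auto. Qed.

Lemma length_append a b : String.length (a ++ b) = String.length a + String.length b.
Proof. induction a; simpl; auto. Qed.

Lemma substring_all s n : String.length s <= n -> substring 0 n s = s.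
Proof. revert n; induction s; intros [|n]; simpl; intros; auto; try lia. f_equal; apply IHs; lia. Qed.

Lemma substring_0_0 s : substring 0 0 s = "".
Proof. destruct s; auto. Qed.

Lemma str_drop_append a b : str_drop (Z.of_nat (String.length a)) (a ++ b) = b.
Proof.
  unfold str_drop. rewrite Nat2Z.id.
  assert (H : forall n, String.length b <= n -> substring (String.length a) n (a ++ b) = b).
  { induction a; simpl; intros; auto using substring_all. }
  apply H. rewrite length_append; lia.
Qed.

Lemma str_take_append a b : str_take (Z.of_nat (String.length a)) (a ++ b) = a.
Proof.
  unfold str_take. rewrite Nat2Z.id.
  induction a; simpl; auto using substring_0_0. f_equal; auto.
Qed.

Fixpoint str_in (c : ascii) (s : string) : bool :=
  match s with
  | EmptyString => false
  | String d r => Ascii.eqb c d || str_in c r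
  end.

Lemma string_to_int_to_string z : string_to_int (int_to_string z) = Some z.
Proof.
  unfold string_to_int, int_to_string. rewrite NilEmpty.isi; simpl. rewrite of_to; auto.
Qed.

(** Guarantees that the first separator the parser meets is the one the serializer wrote, even if
    the text after it contains the same character. *)
Lemma int_to_string_no_sep c z : c = ":"%char \/ c = ";"%char -> str_in c (int_to_string z) = false.
Proof.
  intros Hc. assert (Hu : forall d, str_in c (NilEmpty.string_of_uint d) = false).
  { induction d; simpl; auto; rewrite IHd; destruct Hc; subst; auto. }
  unfold int_to_string, NilEmpty.string_of_int. destruct (Z.to_int z); simpl; auto.
  rewrite Hu; destruct Hc; subst; auto.
Qed.

Ltac evb :=
  first [solve [apply ev_val; auto]
        | eapply ev_binop; [evb|evb|reflexivity]
        | eapply ev_unop; [evb|reflexivity] ].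

(** The loop invariant of the search: [pre1] has been scanned, [pre2] remains before the separator.
    The counter is an expression [e] because the recursive call passes [k + 1] unevaluated. *)
Lemma find_ch_ev c post : forall pre2 pre1 e,
  str_in c pre2 = false -> ev e (Int (Z.of_nat (String.length pre1))) ->
  ev (App2 (find_ch (String c "")) (Str (pre1 ++ pre2 ++ String c post)) e)
     (Int (Z.of_nat (String.length (pre1 ++ pre2)))).
Proof.
  induction pre2 as [|d pre2 IH]; intros pre1 e Hc He.
  - eapply ev_app; [eapply ev_app; [apply ev_val; constructor|apply ev_val; auto|]|exact He|].
    + simpl. apply ev_val; constructor.
    + simpl. eapply ev_if; [evb|].
      rewrite length_append; simpl. replace (Z.leb _ _) with false by (symmetry; apply Z.leb_gt; lia).
      eapply ev_if; [evb|].
      rewrite str_drop_append. simpl. rewrite substring_0_0, Ascii.eqb_refl; simpl.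
      rewrite append_nil_r. apply ev_val; auto.
  - eapply ev_app; [eapply ev_app; [apply ev_val; constructor|apply ev_val; auto|]|exact He|].
    + simpl. apply ev_val; constructor.
    + simpl. eapply ev_if; [evb|].
      rewrite length_append; simpl. replace (Z.leb _ _) with false by (symmetry; apply Z.leb_gt; lia).
      eapply ev_if; [evb|].
      simpl in Hc. apply Bool.orb_false_iff in Hc as [Hd Hc].
      rewrite str_drop_append. simpl. rewrite substring_0_0, Ascii.eqb_sym, Hd; simpl.
      replace (pre1 ++ String d (pre2 ++ String c post)) with ((pre1 ++ String d "") ++ pre2 ++ String c post)
        by (rewrite append_assoc; auto).
      replace (pre1 ++ String d pre2) with ((pre1 ++ String d "") ++ pre2)
        by (rewrite append_assoc; auto).
      apply IH; auto.
      eapply ev_binop; [apply ev_val; auto|apply ev_val; auto|].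
      rewrite length_append, Nat2Z.inj_add; reflexivity.
Qed.

(** * Serialization *)

(** What all serializers compute, read off from the value alone. The default case stands for values
    of types without evidence, such as booleans and functions. *)
Fixpoint ser (v : expr) : string :=
  match v with
  | Lit (LStr s) => "s" ++ (int_to_string (Z.of_nat (String.length s)) ++ (":" ++ s))
  | Lit (LInt z) => "i" ++ (int_to_string z ++ ";")
  | Pair a b => "p" ++ (ser a ++ ser b)
  | InjL a => "l" ++ ser a
  | InjR a => "r" ++ ser a
  | Fold a => ser a
  | _ => ""
  end.

(** The arbitrary [rest] makes parsers composable: the parser of pairs hands what its first
    component leaves over to the second. A round trip at the given value is all that has to be known
    of a parser, since [unauth] parses a string only after its hash has been checked. *)
Definition codec (E v : expr) : Prop :=
  ev (App (Fst E) v) (Str (ser v)) /\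
  forall rest, ev (App (Snd E) (Str (ser v ++ rest))) (ESome (Pair v (Str rest))).

Lemma str_take_1 c r : str_take 1 (String c r) = String c "".
Proof. apply (str_take_append (String c "") r). Qed.

Lemma str_drop_1 c r : str_drop 1 (String c r) = r.
Proof. apply (str_drop_append (String c "") r). Qed.

Lemma evb_binop op e1 e2 w1 w2 v v' :
  ev e1 w1 -> ev e2 w2 -> bin_op_eval op w1 w2 = Some v -> v = v' -> ev (BinOp op e1 e2) v'.
Proof. intros; subst; eapply ev_binop; eauto. Qed.

Lemma codec_string s : codec evi_stringV (Str s).
Proof.
  split.
  - eapply ev_app; [eapply ev_fst, ev_val; repeat constructor|apply ev_val; auto|simpl].
    eapply evb_binop; [evb|evb|reflexivity|reflexivity].
  - intros rest.
    eapply ev_app; [eapply ev_snd, ev_val; repeat constructor|apply ev_val; auto|simpl].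
    set (n := String.length s). set (k := int_to_string (Z.of_nat n)).
    rewrite append_assoc; simpl.
    eapply ev_if with (b := true).
    { eapply evb_binop; [evb|evb|reflexivity|]. rewrite str_take_1; reflexivity. }
    eapply ev_app; [apply ev_val; auto|evb|rewrite str_drop_1; simpl].
    eapply ev_app; [apply ev_val; auto| |].
    { apply (find_ch_ev ":" (s ++ rest) k "").
      - apply int_to_string_no_sep; auto.
      - apply ev_val; auto. }
    simpl. eapply ev_if with (b := false).
    { eapply evb_binop; [evb|evb|reflexivity|].
      do 2 f_equal; apply Z.ltb_ge; simpl; lia. }
    eapply ev_caser.
    { eapply ev_unop; [evb|]. rewrite str_take_append. simpl.
      unfold k; rewrite string_to_int_to_string; reflexivity. }
    simpl. eapply ev_app; [apply ev_val; auto| |].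
    { eapply evb_binop; [evb|evb|reflexivity|].
      (* Dropping one character more than the length of [k] also skips the separator, so the dropped
         prefix is [k] followed by the colon. *)
      replace (k ++ String ":" (s ++ rest)) with ((k ++ ":") ++ (s ++ rest)) by apply append_assoc.
      replace (Z.of_nat (String.length k) + 1)%Z with (Z.of_nat (String.length (k ++ ":")))
        by (rewrite length_append, Nat2Z.inj_add; reflexivity).
      rewrite str_drop_append; reflexivity. }
    simpl. eapply ev_if with (b := false).
    { eapply evb_binop; [evb|evb|reflexivity|]. do 2 f_equal; apply Z.ltb_ge; lia. }
    eapply ev_if with (b := false).
    { eapply evb_binop; [evb|evb|reflexivity|].
      do 2 f_equal; apply Z.ltb_ge; rewrite length_append; lia. }
    apply ev_injr, ev_pair.
    + eapply evb_binop; [evb|evb|reflexivity|]. unfold n; rewrite str_take_append; reflexivity.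
    + eapply evb_binop; [evb|evb|reflexivity|]. unfold n; rewrite str_drop_append; reflexivity.
Qed.

Lemma codec_int z : codec evi_intV (Int z).
Proof.
  split.
  - eapply ev_app; [eapply ev_fst, ev_val; repeat constructor|apply ev_val; auto|simpl].
    eapply evb_binop; [evb|evb|reflexivity|reflexivity].
  - intros rest.
    eapply ev_app; [eapply ev_snd, ev_val; repeat constructor|apply ev_val; auto|simpl].
    set (k := int_to_string z).
    rewrite append_assoc; simpl.
    eapply ev_if with (b := true).
    { eapply evb_binop; [evb|evb|reflexivity|]. rewrite str_take_1; reflexivity. }
    eapply ev_app; [apply ev_val; auto|evb|rewrite str_drop_1; simpl].
    eapply ev_app; [apply ev_val; auto| |].
    { apply (find_ch_ev ";" rest k "").
      - apply int_to_string_no_sep; auto.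
      - apply ev_val; auto. }
    simpl. eapply ev_if with (b := false).
    { eapply evb_binop; [evb|evb|reflexivity|].
      do 2 f_equal; apply Z.ltb_ge; simpl; lia. }
    eapply ev_caser.
    { eapply ev_unop; [evb|]. rewrite str_take_append. simpl.
      unfold k; rewrite string_to_int_to_string; reflexivity. }
    simpl. apply ev_injr, ev_pair; [evb|].
    eapply evb_binop; [evb|evb|reflexivity|].
    replace (k ++ String ";" rest) with ((k ++ ";") ++ rest) by apply append_assoc.
    replace (Z.of_nat (String.length k) + 1)%Z with (Z.of_nat (String.length (k ++ ";")))
      by (rewrite length_append, Nat2Z.inj_add; reflexivity).
    rewrite str_drop_append; reflexivity.
Qed.

(** The evidence that [evi_pairV] returns, as a function of its two arguments; [sumV] and [muV]
    likewise. *)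
Definition pairV (x1 x2 : expr) : expr :=
  Pair
    (Lam "v" (Cat (Str "p") (Cat (App (Fst x1) (Fst (Var "v"))) (App (Fst x2) (Snd (Var "v"))))))
    (Lam "s" (If (EqE (Take (Var "s") (Int 1)) (Str "p"))
       (MatchOpt (App (Snd x1) (Drop (Var "s") (Int 1))) ENone "r1"
       (MatchOpt (App (Snd x2) (Snd (Var "r1"))) ENone "r2"
          (ESome (Pair (Pair (Fst (Var "r1")) (Fst (Var "r2"))) (Snd (Var "r2"))))))
       ENone)).

Definition sumV (x1 x2 : expr) : expr :=
  Pair
    (Lam "v" (Case (Var "v")
                "a" (Cat (Str "l") (App (Fst x1) (Var "a")))
                "b" (Cat (Str "r") (App (Fst x2) (Var "b")))))
    (Lam "s" (Let "t" (Take (Var "s") (Int 1))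
       (If (EqE (Var "t") (Str "l"))
          (MatchOpt (App (Snd x1) (Drop (Var "s") (Int 1))) ENone "r"
             (ESome (Pair (InjL (Fst (Var "r"))) (Snd (Var "r")))))
       (If (EqE (Var "t") (Str "r"))
          (MatchOpt (App (Snd x2) (Drop (Var "s") (Int 1))) ENone "r"
             (ESome (Pair (InjR (Fst (Var "r"))) (Snd (Var "r")))))
          ENone)))).

Definition muV (x : expr) : expr :=
  Pair
    (Lam "v" (App (Fst x) (Unfold (Var "v"))))
    (Lam "s" (MatchOpt (App (Snd x) (Var "s")) ENone "r"
                (ESome (Pair (Fold (Fst (Var "r"))) (Snd (Var "r")))))).

Lemma ev_cat e1 e2 a b : ev e1 (Str a) -> ev e2 (Str b) -> ev (Cat e1 e2) (Str (a ++ b)).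
Proof. intros; eapply ev_binop; eauto. Qed.

Ltac subst_closed_tac :=
  simpl; repeat match goal with H : closedb [] ?E = true |- context [subst ?y ?w ?E] =>
    rewrite (subst_closed y w E H) end.

Lemma codec_pair E1 E2 v1 v2 :
  is_val v1 -> is_val v2 -> closedb [] E1 = true -> closedb [] E2 = true ->
  closedb [] v1 = true -> closedb [] v2 = true ->
  codec E1 v1 -> codec E2 v2 -> codec (pairV E1 E2) (Pair v1 v2).
Proof.
  intros V1 V2 C1 C2 C3 C4 [S1 D1] [S2 D2]; split.
  - eapply ev_app; [eapply ev_fst, ev_val; repeat constructor|apply ev_val; auto|subst_closed_tac].
    apply (ev_cat _ _ "p"); [evb|].
    apply ev_cat; (eapply ev_app_arg; [|eassumption|]; auto).
    + eapply ev_fst, ev_val; auto.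
    + eapply ev_snd, ev_val; auto.
  - intros rest.
    eapply ev_app; [eapply ev_snd, ev_val; repeat constructor|apply ev_val; auto|subst_closed_tac].
    rewrite append_assoc.
    eapply ev_if with (b := true).
    { eapply evb_binop; [evb|evb|reflexivity|]. rewrite str_take_1; reflexivity. }
    eapply ev_caser.
    { eapply ev_app_arg; [|apply D1|]; auto.
      eapply evb_binop; [evb|evb|reflexivity|]. rewrite str_drop_1; reflexivity. }
    subst_closed_tac. eapply ev_caser.
    { eapply ev_app_arg; [|apply D2|]; auto. eapply ev_snd, ev_val; auto. }
    subst_closed_tac. apply ev_injr, ev_pair; [apply ev_pair|];
      [eapply ev_fst, ev_val| eapply ev_fst, ev_val|eapply ev_snd, ev_val]; auto.
Qed.

Lemma codec_inl E1 E2 v :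
  is_val v -> closedb [] E1 = true -> closedb [] E2 = true -> closedb [] v = true ->
  codec E1 v -> codec (sumV E1 E2) (InjL v).
Proof.
  intros V1 C1 C2 C3 [S1 D1]; split.
  - eapply ev_app; [eapply ev_fst, ev_val; repeat constructor|apply ev_val; auto|subst_closed_tac].
    eapply ev_casel; [apply ev_val; auto|subst_closed_tac].
    apply (ev_cat _ _ "l"); [evb|eassumption].
  - intros rest.
    eapply ev_app; [eapply ev_snd, ev_val; repeat constructor|apply ev_val; auto|subst_closed_tac].
    eapply ev_app; [apply ev_val; auto|evb|subst_closed_tac].
    eapply ev_if with (b := true).
    { eapply evb_binop; [evb|evb|reflexivity|]. rewrite str_take_1; reflexivity. }
    eapply ev_caser.
    { eapply ev_app_arg; [|apply D1|]; auto.
      eapply evb_binop; [evb|evb|reflexivity|]. rewrite str_drop_1; reflexivity. }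
    simpl. apply ev_injr, ev_pair; [apply ev_injl, ev_fst with (Str rest)|eapply ev_snd];
      apply ev_val; auto.
Qed.

Lemma codec_inr E1 E2 v :
  is_val v -> closedb [] E1 = true -> closedb [] E2 = true -> closedb [] v = true ->
  codec E2 v -> codec (sumV E1 E2) (InjR v).
Proof.
  intros V1 C1 C2 C3 [S1 D1]; split.
  - eapply ev_app; [eapply ev_fst, ev_val; repeat constructor|apply ev_val; auto|subst_closed_tac].
    eapply ev_caser; [apply ev_val; auto|subst_closed_tac].
    apply (ev_cat _ _ "r"); [evb|eassumption].
  - intros rest.
    eapply ev_app; [eapply ev_snd, ev_val; repeat constructor|apply ev_val; auto|subst_closed_tac].
    eapply ev_app; [apply ev_val; auto|evb|subst_closed_tac].
    eapply ev_if with (b := false).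
    { eapply evb_binop; [evb|evb|reflexivity|]. rewrite str_take_1; reflexivity. }
    eapply ev_if with (b := true).
    { eapply evb_binop; [evb|evb|reflexivity|]. rewrite str_take_1; reflexivity. }
    eapply ev_caser.
    { eapply ev_app_arg; [|apply D1|]; auto.
      eapply evb_binop; [evb|evb|reflexivity|]. rewrite str_drop_1; reflexivity. }
    simpl. apply ev_injr, ev_pair; [apply ev_injr, ev_fst with (Str rest)|eapply ev_snd];
      apply ev_val; auto.
Qed.

Lemma codec_fold E v :
  is_val v -> closedb [] E = true -> closedb [] v = true ->
  codec E v -> codec (muV E) (Fold v).
Proof.
  intros V1 C1 C3 [S1 D1]; split.
  - eapply ev_app; [eapply ev_fst, ev_val; repeat constructor|apply ev_val; auto|subst_closed_tac].
    eapply ev_app_arg; [|eassumption|]; auto. apply ev_unfold, ev_val; auto.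
  - intros rest.
    eapply ev_app; [eapply ev_snd, ev_val; repeat constructor|apply ev_val; auto|subst_closed_tac].
    eapply ev_caser; [apply D1|].
    simpl. apply ev_injr, ev_pair; [apply ev_fold, ev_fst with (Str rest)|eapply ev_snd];
      apply ev_val; auto.
Qed.

(** * The simulation relation *)

(** The shapes that applied library functions take at run time, with their arguments as holes. The
    rules of [rel] for computations recognise these shapes. *)
Definition retV (x : expr) : expr := Lam "p" (ESome (Pair (Var "p") x)).
Definition thunkI (x : expr) : expr := Lam "u" x.
Definition bindVb (c f : expr) : expr :=
  Lam "p" (MatchOpt (App c (Var "p")) ENone "r" (App2 f (Snd (Var "r")) (Fst (Var "r")))).
Definition bindIb (c f : expr) : expr := App2 f (App c Unit) Unit.
Definition unauthBody (E h c : expr) : expr :=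
  MatchOpt (App (Snd E) (Var "s")) ENone "r"
    (If (EqE (Snd (Var "r")) (Str "")) (ESome (Pair (Snd c) (Fst (Var "r")))) ENone).
Definition unauthVb (E h : expr) : expr :=
  Lam "p" (Case (Unfold (Var "p")) "_" ENone "c"
    (Let "s" (Fst (Var "c"))
      (If (EqE (Hash (Var "s")) h) (unauthBody E h (Var "c")) ENone))).
Definition unauthF (E : expr) : expr := Lam "h" (unauthVb E (Var "h")).

Definition uK (c : tconst) : uty := UC (UK c).
Definition uarrow (a b : uty) : uty := UApp (UApp (uK CArrow) a) b.
Definition uprod (a b : uty) : uty := UApp (UApp (uK CProd) a) b.
Definition usum (a b : uty) : uty := UApp (UApp (uK CSum) a) b.
Definition umu (k : kind) (F : uty) : uty := UApp (uK (CMu k)) F.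
Definition uauth (a : uty) : uty := UApp (UC UAuth) a.
Definition uM (a : uty) : uty := UApp (UC UM) a.
Definition uevi (a : uty) : uty := UApp (UC UEvi) a.

Fixpoint uapps (t : uty) (args : list uty) : uty :=
  match args with
  | [] => t
  | a :: r => uapps (UApp t a) r
  end.

Definition uctx := list (string * uty).

Fixpoint ulookup (G : uctx) (x : string) : option uty :=
  match G with
  | [] => None
  | (y, t) :: G' => if String.eqb x y then Some t else ulookup G' x
  end.

(* The arguments of a library function are values at run time and, in its
   definition, variables among the names [N] of its parameters.  In the rules
   below, [N] avoids the names bound in the body of the library function. *)
Definition atom (N : list string) (x : expr) : Prop :=
  (is_val x /\ closedb [] x = true) \/ exists z, x = Var z /\ In z N.

Definition eviN : list string := ["e1"; "e2"; "e"; "evi"].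

(* Pairs of related locations with their type, and the hash history of the verifier. *)
Definition world : Type := list (nat * nat * uty) * list string.

Definition wle (W W' : world) : Prop := incl (fst W) (fst W') /\ incl (snd W) (snd W').

Section Rel.
Context {I : Type} (hashf : I -> string -> string) (i : I).
Local Notation hf := (hashf i).

(* [rel_TAbs] and [rel_Unpack] have a premise for every type [s], well-kinded or
   not, so that there is no context of type variables.  [rel_authrun] is a
   serialization in progress, under the final [Hash] of [auth]. *)
Inductive rel (W : world) : uctx -> expr -> expr -> uty -> Prop :=
| rel_Var G x t : ulookup G x = Some t -> rel W G (Var x) (Var x) t
| rel_Unit G : rel W G Unit Unit (uK CUnit)
| rel_Bool G b : rel W G (Lit (LBool b)) (Lit (LBool b)) (uK CBool)
| rel_Int G z : rel W G (Lit (LInt z)) (Lit (LInt z)) (uK CInt)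
| rel_Str G s : rel W G (Lit (LStr s)) (Lit (LStr s)) (uK CString)
| rel_Rec G f x b1 b2 t1 t2 :
    rel W ((x, t1) :: (f, uarrow t1 t2) :: G) b1 b2 t2 ->
    rel W G (Rec f x b1) (Rec f x b2) (uarrow t1 t2)
| rel_App G a1 a2 b1 b2 t1 t2 :
    rel W G a1 a2 (uarrow t1 t2) -> rel W G b1 b2 t1 -> rel W G (App a1 b1) (App a2 b2) t2
| rel_UnOp G op e1 e2 t1 t :
    un_op_typed op t1 t -> rel W G e1 e2 (er t1) -> rel W G (UnOp op e1) (UnOp op e2) (er t)
| rel_BinOp G op a1 a2 b1 b2 t1 t2 t :
    bin_op_typed op t1 t2 t -> rel W G a1 a2 (er t1) -> rel W G b1 b2 (er t2) ->
    rel W G (BinOp op a1 b1) (BinOp op a2 b2) (er t)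
| rel_If G a1 a2 b1 b2 c1 c2 t :
    rel W G a1 a2 (uK CBool) -> rel W G b1 b2 t -> rel W G c1 c2 t ->
    rel W G (If a1 b1 c1) (If a2 b2 c2) t
| rel_Pair G a1 a2 b1 b2 t1 t2 :
    rel W G a1 a2 t1 -> rel W G b1 b2 t2 -> rel W G (Pair a1 b1) (Pair a2 b2) (uprod t1 t2)
| rel_Fst G e1 e2 t1 t2 : rel W G e1 e2 (uprod t1 t2) -> rel W G (Fst e1) (Fst e2) t1
| rel_Snd G e1 e2 t1 t2 : rel W G e1 e2 (uprod t1 t2) -> rel W G (Snd e1) (Snd e2) t2
| rel_InjL G e1 e2 t1 t2 : rel W G e1 e2 t1 -> rel W G (InjL e1) (InjL e2) (usum t1 t2)
| rel_InjR G e1 e2 t1 t2 : rel W G e1 e2 t2 -> rel W G (InjR e1) (InjR e2) (usum t1 t2)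
| rel_Case G a1 a2 x b1 b2 y c1 c2 t1 t2 t :
    rel W G a1 a2 (usum t1 t2) -> rel W ((x, t1) :: G) b1 b2 t -> rel W ((y, t2) :: G) c1 c2 t ->
    rel W G (Case a1 x b1 y c1) (Case a2 x b2 y c2) t
| rel_TAbs G k T e1 e2 :
    (forall s, rel W G e1 e2 (UApp T s)) -> rel W G (TAbs e1) (TAbs e2) (UApp (uK (CForall k)) T)
| rel_TInst G k T s e1 e2 :
    rel W G e1 e2 (UApp (uK (CForall k)) T) -> rel W G (TInst e1) (TInst e2) (UApp T s)
| rel_Pack G k T s e1 e2 :
    rel W G e1 e2 (UApp T s) -> rel W G (Pack e1) (Pack e2) (UApp (uK (CExists k)) T)
| rel_Unpack G k T x e1 e2 b1 b2 t :
    rel W G e1 e2 (UApp (uK (CExists k)) T) ->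
    (forall s, rel W ((x, UApp T s) :: G) b1 b2 t) ->
    rel W G (Unpack e1 x b1) (Unpack e2 x b2) t
| rel_Fold G k F args e1 e2 :
    rel W G e1 e2 (uapps (UApp F (umu k F)) args) ->
    rel W G (Fold e1) (Fold e2) (uapps (umu k F) args)
| rel_Unfold G k F args e1 e2 :
    rel W G e1 e2 (uapps (umu k F) args) ->
    rel W G (Unfold e1) (Unfold e2) (uapps (UApp F (umu k F)) args)
| rel_Alloc G e1 e2 t : rel W G e1 e2 t -> rel W G (Alloc e1) (Alloc e2) (UApp (uK CRef) t)
| rel_Deref G e1 e2 t : rel W G e1 e2 (UApp (uK CRef) t) -> rel W G (Deref e1) (Deref e2) t
| rel_Store G a1 a2 b1 b2 t :
    rel W G a1 a2 (UApp (uK CRef) t) -> rel W G b1 b2 t ->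
    rel W G (Store a1 b1) (Store a2 b2) (uK CUnit)
| rel_Loc G l1 l2 t : In (l1, l2, t) (fst W) -> rel W G (Loc l1) (Loc l2) (UApp (uK CRef) t)
| rel_Hash G e1 e2 : rel W G e1 e2 (uK CString) -> rel W G (Hash e1) (Hash e2) (uK CString)
| rel_Conv G e1 e2 t t' : rel W G e1 e2 t -> conv t t' -> rel W G e1 e2 t'
| rel_ret G x y a :
    atom ["a"] x -> atom ["a"] y -> rel W G x y a -> rel W G (retV x) (thunkI y) (uM a)
| rel_bind G c1 c2 f1 f2 a b :
    atom ["c"; "f"] c1 -> atom ["c"; "f"] c2 -> atom ["c"; "f"] f1 -> atom ["c"; "f"] f2 ->
    rel W G c1 c2 (uM a) -> rel W G f1 f2 (uarrow a (uM b)) ->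
    rel W G (bindVb c1 f1) (thunkI (bindIb c2 f2)) (uM b)
| rel_auth G E E' x y a :
    rel W G E E' (uevi a) -> rel W G x y a -> atom ["evi"] E -> atom ["a"] x ->
    rel W G (Hash (App (Fst E) x)) y (uauth a)
| rel_authrun G z v1 v2 a :
    closedb [] z = true -> psteps z (Str (ser v1)) -> is_val v1 -> is_val v2 ->
    rel W [] v1 v2 a -> rel W G (Hash z) v2 (uauth a)
| rel_authv G v1 v2 a :
    is_val v1 -> is_val v2 -> rel W [] v1 v2 a -> In (ser v1) (snd W) ->
    rel W G (Lit (LStr (hf (ser v1)))) v2 (uauth a)
| rel_unauthf G E E' a :
    atom ["evi"] E -> rel W G E E' (uevi a) ->
    rel W G (unauthF E) (Lam "a" (thunkI (Var "a"))) (uarrow (uauth a) (uM a))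
| rel_unauth G E E' h y a :
    atom [] E -> atom [] h -> atom [] y -> rel W G E E' (uevi a) -> rel W G h y (uauth a) ->
    rel W G (unauthVb E h) (thunkI y) (uM a)
| rel_evistr G : rel W G evi_stringV Unit (uevi (uK CString))
| rel_eviauth G a : rel W G evi_stringV Unit (uevi (uauth a))
| rel_eviint G : rel W G evi_intV Unit (uevi (uK CInt))
| rel_evipair G x1 y1 x2 y2 a b :
    atom eviN x1 -> atom eviN x2 -> rel W G x1 y1 (uevi a) -> rel W G x2 y2 (uevi b) ->
    rel W G (pairV x1 x2) Unit (uevi (uprod a b))
| rel_evisum G x1 y1 x2 y2 a b :
    atom eviN x1 -> atom eviN x2 -> rel W G x1 y1 (uevi a) -> rel W G x2 y2 (uevi b) ->
    rel W G (sumV x1 x2) Unit (uevi (usum a b))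
| rel_evimu G x y k F :
    atom eviN x -> rel W G x y (uevi (UApp F (umu k F))) ->
    rel W G (muV x) Unit (uevi (umu k F)).

Ltac rel_con :=
  first
  [ eapply rel_ret | eapply rel_bind | eapply rel_auth | eapply rel_authrun | eapply rel_authv
  | eapply rel_unauthf | eapply rel_unauth | eapply rel_evistr | eapply rel_eviauth | eapply rel_eviint
  | eapply rel_evipair | eapply rel_evisum | eapply rel_evimu
  | eapply rel_Var | eapply rel_Unit | eapply rel_Bool | eapply rel_Int | eapply rel_Str | eapply rel_Rec
  | eapply rel_App | eapply rel_UnOp | eapply rel_BinOp | eapply rel_If | eapply rel_Pair | eapply rel_Fst
  | eapply rel_Snd | eapply rel_InjL | eapply rel_InjR | eapply rel_Case | eapply rel_TAbs
  | eapply rel_TInst | eapply rel_Pack | eapply rel_Unpack | eapply rel_Fold | eapply rel_Unfold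
  | eapply rel_Alloc | eapply rel_Deref | eapply rel_Store | eapply rel_Loc | eapply rel_Hash
  | eapply rel_Conv; [|eassumption] ].

Lemma rel_mono W W' G e1 e2 t : wle W W' -> rel W G e1 e2 t -> rel W' G e1 e2 t.
Proof.
  intros [HS HH]; induction 1; rel_con; eauto.
Qed.

(** One direction only: under [rel_auth] and [rel_authrun] the verifier still serializes and hashes
    while the ideal side may already be a value. *)
Lemma rel_is_val W G e1 e2 t : rel W G e1 e2 t -> is_val e1 -> is_val e2.
Proof.
  induction 1; intros Hv; inversion Hv; subst; auto; unfold thunkI; auto.
Qed.

Lemma rel_weaken W G e1 e2 t : rel W G e1 e2 t ->
  forall G', (forall x s, ulookup G x = Some s -> ulookup G' x = Some s) -> rel W G' e1 e2 t.
Proof.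
  induction 1; intros G' HG; rel_con; try eassumption; auto; intros;
    match goal with IH : context [rel _ _ ?e _ _] |- rel _ _ ?e _ _ => eapply IH end;
    intros z s'; simpl; repeat (destruct (String.eqb z _); eauto).
Qed.

Lemma rel_closed W G e1 e2 t : rel W G e1 e2 t ->
  closedb (map fst G) e1 = true /\ closedb (map fst G) e2 = true.
Proof.
  assert (HL : forall x t G, ulookup G x = Some t -> In x (map fst G)).
  { intros x s; induction G0 as [|[y u] G0 IH]; simpl; [discriminate|].
    destruct (String.eqb_spec x y); subst; auto. }
  induction 1; cbn [map fst] in *;
    repeat match goal with H : _ /\ _ |- _ => destruct H end;
    (* [UVar 0] is an arbitrary instance of the premises that range over all types; closedness does
       not depend on it. *)
    repeat match goal with H : forall s : uty, _ /\ _ |- _ => destruct (H (UVar 0)); clear H end;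
    split; simpl; rewrite ?Bool.andb_true_iff, ?existsb_eqb; try reflexivity;
    repeat match goal with |- _ /\ _ => split end;
    match goal with
    | |- ?a = ?a => reflexivity
    | H : closedb ?L ?e = true |- closedb ?L' ?e = true =>
       apply (closedb_incl e L L' H); intros ?; simpl; tauto
    | _ => eauto
    end.
Qed.

Lemma rel_closed_nil W e1 e2 t : rel W [] e1 e2 t -> closedb [] e1 = true /\ closedb [] e2 = true.
Proof. apply rel_closed. Qed.

(** * Substitution in related terms *)

Lemma atom_subst_id N x y w : atom N x -> ~ In y N -> subst y w x = x.
Proof.
  intros [[_ Hc]|(z & -> & Hz)] Hy; [apply subst_closed; auto|simpl].
  destruct (String.eqb_spec z y); subst; tauto.
Qed.

Lemma atom_subst N x y w : is_val w -> closedb [] w = true -> atom N x -> atom N (subst y w x).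
Proof.
  intros Hv Hw [[Hx Hc]|(z & -> & Hz)].
  - left; rewrite subst_closed; auto.
  - simpl. destruct (String.eqb z y); [left|right]; eauto.
Qed.

#[local] Arguments String.eqb : simpl never.

Ltac eqb_const :=
  repeat (match goal with
    | |- context [String.eqb ?c ?d] =>
      let b := eval vm_compute in (String.eqb c d) in
      match b with true => idtac | false => idtac end;
      change (String.eqb c d) with b
    end; simpl).

Ltac tsub := simpl;
  repeat (match goal with
    | |- context [String.eqb ?c ?y] =>
      is_var y; destruct (String.eqb_spec c y);
        [subst y; eqb_const;
         repeat (match goal with H : atom ?N ?x |- context [subst ?z ?w ?x] =>
           rewrite (atom_subst_id N x z w H) by (simpl; intuition discriminate) end) | ]
    end; simpl); try reflexivity.

(** If [y] is bound by the library code, substitution stops at that binder; by [atom] the holes do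
    not mention [y] then, so substituting in them changes nothing either. The same argument serves
    the other shapes. *)
Lemma subst_retV x y w : atom ["a"] x -> subst y w (retV x) = retV (subst y w x).
Proof. intros; unfold retV, Lam. tsub. Qed.

Lemma subst_thunkI N x y w : atom N x -> ~ In "u" N -> ~ In "" N ->
  subst y w (thunkI x) = thunkI (subst y w x).
Proof.
  intros; unfold thunkI, Lam. simpl.
  destruct (String.eqb_spec "" y), (String.eqb_spec "u" y); subst; simpl; auto;
    rewrite (atom_subst_id N) by auto; auto.
Qed.

Lemma subst_bindVb c f y w : atom ["c"; "f"] c -> atom ["c"; "f"] f ->
  subst y w (bindVb c f) = bindVb (subst y w c) (subst y w f).
Proof. intros; unfold bindVb, Lam. tsub. Qed.

Lemma subst_thunk_bindI c f y w : atom ["c"; "f"] c -> atom ["c"; "f"] f ->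
  subst y w (thunkI (bindIb c f)) = thunkI (bindIb (subst y w c) (subst y w f)).
Proof. intros; unfold thunkI, bindIb, Lam. tsub. Qed.

Lemma subst_unauthF E y w : atom ["evi"] E -> subst y w (unauthF E) = unauthF (subst y w E).
Proof. intros; unfold unauthF, unauthVb, Lam. tsub. Qed.

Lemma subst_unauthVb E h y w : atom [] E -> atom [] h ->
  subst y w (unauthVb E h) = unauthVb (subst y w E) (subst y w h).
Proof. intros; unfold unauthVb, Lam. tsub. Qed.

Lemma subst_pairV x1 x2 y w : atom eviN x1 -> atom eviN x2 ->
  subst y w (pairV x1 x2) = pairV (subst y w x1) (subst y w x2).
Proof. intros; unfold pairV, Lam. tsub. Qed.

Lemma subst_sumV x1 x2 y w : atom eviN x1 -> atom eviN x2 ->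
  subst y w (sumV x1 x2) = sumV (subst y w x1) (subst y w x2).
Proof. intros; unfold sumV, Lam. tsub. Qed.

Lemma subst_muV x y w : atom eviN x -> subst y w (muV x) = muV (subst y w x).
Proof. intros; unfold muV, Lam. tsub. Qed.

Lemma rel_weaken_nil W G e1 e2 t : rel W [] e1 e2 t -> rel W G e1 e2 t.
Proof. intros H; eapply rel_weaken; [exact H|discriminate]. Qed.

(** The contexts are compared by lookup instead of as lists, so that the substituted variable may
    lie under any number of other bindings. *)
Lemma rel_subst W G e1 e2 t : rel W G e1 e2 t -> forall G' x u w1 w2,
  (forall y, ulookup G y = if String.eqb y x then Some u else ulookup G' y) ->
  is_val w1 -> is_val w2 -> rel W [] w1 w2 u ->
  rel W G' (subst x w1 e1) (subst x w2 e2) t.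
Proof.
  assert (Hext : forall (G G' : uctx) x (u : uty),
     (forall y, ulookup G y = if String.eqb y x then Some u else ulookup G' y) ->
     forall z s, z <> x -> forall y,
     ulookup ((z, s) :: G) y = if String.eqb y x then Some u else ulookup ((z, s) :: G') y).
  { intros G0 G0' x u HG z s Hz y. simpl. rewrite HG.
    destruct (String.eqb_spec y z), (String.eqb_spec y x); subst; congruence. }
  assert (Hshd : forall (G G' : uctx) x (u : uty),
     (forall y, ulookup G y = if String.eqb y x then Some u else ulookup G' y) ->
     forall s y t, ulookup ((x, s) :: G) y = Some t -> ulookup ((x, s) :: G') y = Some t).
  { intros G0 G0' x u HG s y t0. simpl. rewrite HG. destruct (String.eqb y x); auto. }
  induction 1; intros G' x0 u w1 w2 HG Hv1 Hv2 Hw;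
    destruct (rel_closed_nil _ _ _ _ Hw) as [Hc1 Hc2];
    try (simpl; rel_con; eauto; fail).
  - simpl. rewrite HG in H. destruct (String.eqb_spec x x0); [|constructor; auto].
    injection H as ->. apply rel_weaken_nil; auto.
  - simpl. destruct (String.eqb_spec x x0); subst; [|destruct (String.eqb_spec f x0); subst]; simpl;
      rewrite ?Bool.orb_true_r; apply rel_Rec.
    + eapply rel_weaken; [exact H|]. intros z s. simpl. rewrite HG.
      destruct (String.eqb z x0); auto.
    + eapply rel_weaken; [exact H|]. intros z s. simpl. rewrite HG.
      destruct (String.eqb z x), (String.eqb z x0); auto.
    + eapply IHrel; eauto.
  - simpl. eapply rel_Case; eauto.
    + destruct (String.eqb_spec x x0); subst; eauto.
      eapply rel_weaken; eauto.
    + destruct (String.eqb_spec y x0); subst; eauto.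
      eapply rel_weaken; eauto.
  - simpl. eapply rel_Unpack; eauto. intros s.
    destruct (String.eqb_spec x x0); subst; eauto.
    eapply rel_weaken; eauto.
  - erewrite subst_retV, subst_thunkI by (eauto; simpl; intuition discriminate).
    apply rel_ret; eauto using atom_subst.
  - rewrite subst_bindVb, subst_thunk_bindI by auto.
    eapply rel_bind; eauto using atom_subst.
  - simpl. eapply rel_auth; eauto using atom_subst.
  - simpl. rewrite (subst_closed _ _ z), (subst_closed _ _ v2) by (auto; eapply rel_closed_nil; eauto).
    eapply rel_authrun; eauto.
  - simpl. rewrite (subst_closed _ _ v2) by (eapply rel_closed_nil; eauto).
    eapply rel_authv; eauto.
  - rewrite subst_unauthF, (subst_closed _ _ (Lam "a" _)) by auto.
    eapply rel_unauthf; eauto using atom_subst.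
  - erewrite subst_unauthVb, subst_thunkI by (eauto; simpl; intuition discriminate).
    eapply rel_unauth; eauto using atom_subst.
  - rewrite !subst_closed by auto. constructor.
  - rewrite !subst_closed by auto. constructor.
  - rewrite !subst_closed by auto. constructor.
  - rewrite subst_pairV by auto. eapply rel_evipair; eauto using atom_subst.
  - rewrite subst_sumV by auto. eapply rel_evisum; eauto using atom_subst.
  - rewrite subst_muV by auto. eapply rel_evimu; eauto using atom_subst.
Qed.

Lemma rel_subst_cons W G x u e1 e2 t w1 w2 : rel W ((x, u) :: G) e1 e2 t ->
  is_val w1 -> is_val w2 -> rel W [] w1 w2 u -> rel W G (subst x w1 e1) (subst x w2 e2) t.
Proof. intros H Hv1 Hv2 Hw. eapply rel_subst; eauto. reflexivity. Qed.

(** * Canonical forms of related values *)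

Lemma spine_umu k F args : spine (uapps (umu k F) args) [] = Some (UK (CMu k), F :: args).
Proof.
  assert (H : forall args t l c, spine t [] = Some (c, l) ->
    spine (uapps t args) [] = Some (c, (l ++ args)%list)).
  { assert (Hs : forall t l l' c m, spine t l = Some (c, m) ->
      spine t (l ++ l')%list = Some (c, (m ++ l')%list)).
    { induction t; simpl; intros; try discriminate.
      - change (t2 :: l ++ l')%list with ((t2 :: l) ++ l')%list; auto.
      - injection H as <- <-; auto. }
    induction args0; simpl; intros t l c H; [rewrite app_nil_r; auto|].
    rewrite (IHargs0 (UApp t a) (l ++ [a])%list c), <- app_assoc; auto.
    simpl. apply (Hs t [] [a]); auto. }
  apply (H args (umu k F) [F]); auto.
Qed.

Ltac clash H :=
  exfalso;
  let E := fresh in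
  eapply conv_spine in H as [E _];
    [|first [reflexivity|apply spine_umu]|first [reflexivity|apply spine_umu]];
  discriminate E.

(** Induction on the derivation, with the expected type known only up to [conv], so that the case of
    [rel_Conv] composes two conversions. Rules for values with another head constant are refuted by
    [clash]. *)
Ltac canon :=
  induction 1; intros Hv;
    try (exfalso; inversion Hv; fail);
    intros;
    match goal with
    | IH : is_val _ -> _, Hc : conv ?t ?t', Hc' : conv ?t' _ |- _ =>
       solve [eapply IH; eauto using conv_trans]
    | Hc : conv _ _ |- _ => try (clash Hc; fail)
    | _ => idtac
    end.

Ltac conv_args H :=
  eapply conv_spine in H as [? H]; [|first [reflexivity|apply spine_umu]|first [reflexivity|apply spine_umu]];
  repeat match goal with
  | F : Forall2 _ (_ :: _) (_ :: _) |- _ => inversion F; clear F; subst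
  | F : Forall2 _ [] [] |- _ => clear F
  end.

(** The second alternative comes from [unauth]: its two implementations name the authenticated
    argument [h] and [a], whereas [rel_Rec] relates functions with equal parameter names. *)
Lemma canon_arrow W G e1 e2 t : rel W G e1 e2 t -> is_val e1 -> forall a b, conv t (uarrow a b) ->
  (exists f x b1 b2 a' b', e1 = Rec f x b1 /\ e2 = Rec f x b2 /\ conv a' a /\ conv b' b /\
     rel W ((x, a') :: (f, uarrow a' b') :: G) b1 b2 b') \/
  (exists E E' a', e1 = unauthF E /\ e2 = Lam "a" (thunkI (Var "a")) /\ atom ["evi"] E /\
     rel W G E E' (uevi a') /\ conv (uauth a') a /\ conv (uM a') b).
Proof.
  canon.
  - conv_args H0. left; repeat eexists; eauto.
  - conv_args H1. right; repeat eexists; eauto.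
Qed.

Lemma canon_unit W G e1 e2 t : rel W G e1 e2 t -> is_val e1 -> conv t (uK CUnit) ->
  e1 = Unit /\ e2 = Unit.
Proof. canon. auto. Qed.

Lemma canon_bool W G e1 e2 t : rel W G e1 e2 t -> is_val e1 -> conv t (uK CBool) ->
  exists b, e1 = Lit (LBool b) /\ e2 = Lit (LBool b).
Proof. canon. eauto. Qed.

Lemma canon_int W G e1 e2 t : rel W G e1 e2 t -> is_val e1 -> conv t (uK CInt) ->
  exists z, e1 = Lit (LInt z) /\ e2 = Lit (LInt z).
Proof. canon. eauto. Qed.

Lemma canon_string W G e1 e2 t : rel W G e1 e2 t -> is_val e1 -> conv t (uK CString) ->
  exists s, e1 = Lit (LStr s) /\ e2 = Lit (LStr s).
Proof. canon. eauto. Qed.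

Lemma canon_prod W G e1 e2 t : rel W G e1 e2 t -> is_val e1 -> forall a b, conv t (uprod a b) ->
  exists a1 b1 a2 b2, e1 = Pair a1 b1 /\ e2 = Pair a2 b2 /\ rel W G a1 a2 a /\ rel W G b1 b2 b.
Proof. canon. conv_args H1. repeat eexists; eauto using rel_Conv. Qed.

Lemma canon_sum W G e1 e2 t : rel W G e1 e2 t -> is_val e1 -> forall a b, conv t (usum a b) ->
  exists v1 v2, (e1 = InjL v1 /\ e2 = InjL v2 /\ rel W G v1 v2 a) \/
                (e1 = InjR v1 /\ e2 = InjR v2 /\ rel W G v1 v2 b).
Proof. canon; conv_args H0; repeat eexists; eauto 6 using rel_Conv. Qed.

Lemma canon_forall W G e1 e2 t : rel W G e1 e2 t -> is_val e1 ->
  forall k T, conv t (UApp (uK (CForall k)) T) ->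
  exists b1 b2, e1 = TAbs b1 /\ e2 = TAbs b2 /\ forall s, rel W G b1 b2 (UApp T s).
Proof. canon. conv_args H1. repeat eexists; eauto using rel_Conv, conv_app. Qed.

Lemma canon_exists W G e1 e2 t : rel W G e1 e2 t -> is_val e1 ->
  forall k T, conv t (UApp (uK (CExists k)) T) ->
  exists v1 v2 s, e1 = Pack v1 /\ e2 = Pack v2 /\ rel W G v1 v2 (UApp T s).
Proof. canon. conv_args H0. repeat eexists; eauto using rel_Conv, conv_app. Qed.

Lemma uapps_conv l l' : Forall2 conv l l' -> forall t t', conv t t' -> conv (uapps t l) (uapps t' l').
Proof. induction 1; simpl; auto using conv_app. Qed.

Lemma canon_mu W G e1 e2 t : rel W G e1 e2 t -> is_val e1 ->
  forall k F args, conv t (uapps (umu k F) args) ->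
  exists v1 v2, e1 = Fold v1 /\ e2 = Fold v2 /\ rel W G v1 v2 (uapps (UApp F (umu k F)) args).
Proof.
  canon.
  eapply conv_spine in H0 as [E H0]; [|apply spine_umu|apply spine_umu].
  injection E as <-. inversion H0; subst. repeat eexists; eauto.
  eapply rel_Conv; [eassumption|]. apply uapps_conv; auto.
  apply conv_app; auto. apply conv_app; auto.
Qed.

Lemma canon_ref W G e1 e2 t : rel W G e1 e2 t -> is_val e1 -> forall a, conv t (UApp (uK CRef) a) ->
  exists l1 l2 a', e1 = Loc l1 /\ e2 = Loc l2 /\ In (l1, l2, a') (fst W) /\ conv a' a.
Proof. canon. conv_args H0. repeat eexists; eauto. Qed.

Lemma canon_auth W G e1 e2 t : rel W G e1 e2 t -> is_val e1 -> forall a, conv t (uauth a) ->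
  exists v1, e1 = Lit (LStr (hf (ser v1))) /\ is_val v1 /\ is_val e2 /\ rel W [] v1 e2 a /\
    In (ser v1) (snd W).
Proof.
  canon. conv_args H3. exists v1; repeat split; eauto using rel_Conv.
Qed.

Lemma canon_m W G e1 e2 t : rel W G e1 e2 t -> is_val e1 -> forall a, conv t (uM a) ->
  (exists x y, e1 = retV x /\ e2 = thunkI y /\ atom ["a"] x /\ atom ["a"] y /\ rel W G x y a) \/
  (exists c1 c2 f1 f2 b, e1 = bindVb c1 f1 /\ e2 = thunkI (bindIb c2 f2) /\
     atom ["c"; "f"] c1 /\ atom ["c"; "f"] c2 /\ atom ["c"; "f"] f1 /\ atom ["c"; "f"] f2 /\
     rel W G c1 c2 (uM b) /\ rel W G f1 f2 (uarrow b (uM a))) \/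
  (exists E E' h y, e1 = unauthVb E h /\ e2 = thunkI y /\ atom [] E /\ atom [] h /\ atom [] y /\
     rel W G E E' (uevi a) /\ rel W G h y (uauth a)).
Proof.
  canon.
  - conv_args H2. left; repeat eexists; eauto using rel_Conv.
  - conv_args H5. right; left; exists c1, c2, f1, f2, a; repeat split; eauto.
    eapply rel_Conv; [eassumption|]. unfold uarrow, uM; auto using conv_app.
  - conv_args H4. right; right; exists E, E', h, y; repeat split; auto.
    + eapply rel_Conv; [eassumption|]. unfold uevi; auto using conv_app.
    + eapply rel_Conv; [eassumption|]. unfold uauth; auto using conv_app.
Qed.

Lemma atom_nil N G W e1 e2 t : rel W G e1 e2 t -> G = [] -> atom N e1 -> is_val e1 /\ closedb [] e1 = true.
Proof.
  intros H -> Ha. destruct (rel_closed_nil _ _ _ _ H) as [Hc _]; split; auto.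
  destruct Ha as [[]|(z & -> & _)]; auto. discriminate.
Qed.

(** Induction on the derivation of the evidence, not on the value or its type: at a recursive type,
    the evidence for the unfolding is a subderivation although the type grows. An authenticated
    component ends the recursion, since it is serialized as a string. *)
Lemma rel_evi_codec W G E E' t : rel W G E E' t -> G = [] -> is_val E -> forall a, conv t (uevi a) ->
  forall W' v1 v2, rel W' [] v1 v2 a -> is_val v1 -> codec E v1.
Proof.
  induction 1; intros HG Hv; subst; try (exfalso; inversion Hv; fail);
    intros a0 Hc W' w1 w2 Hw Hvw; try (clash Hc; fail).
  - eapply IHrel; eauto using conv_trans.
  - conv_args Hc. destruct (canon_string _ _ _ _ _ Hw Hvw ltac:(auto)) as (s & -> & _). apply codec_string.
  - conv_args Hc. destruct (canon_auth _ _ _ _ _ Hw Hvw _ ltac:(eauto)) as (s & -> & _). apply codec_string.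
  - conv_args Hc. destruct (canon_int _ _ _ _ _ Hw Hvw ltac:(auto)) as (s & -> & _). apply codec_int.
  - conv_args Hc. destruct (canon_prod _ _ _ _ _ Hw Hvw _ _ ltac:(eauto))
      as (a1 & b1 & a2 & b2 & -> & -> & Ha & Hb).
    inversion Hvw; subst.
    destruct (rel_closed_nil _ _ _ _ Ha), (rel_closed_nil _ _ _ _ Hb).
    destruct (atom_nil _ _ _ _ _ _ H1 eq_refl ltac:(eassumption)).
    destruct (atom_nil _ _ _ _ _ _ H2 eq_refl ltac:(eassumption)).
    apply codec_pair; eauto.
  - conv_args Hc.
    destruct (atom_nil _ _ _ _ _ _ H1 eq_refl ltac:(eassumption)).
    destruct (atom_nil _ _ _ _ _ _ H2 eq_refl ltac:(eassumption)).
    destruct (canon_sum _ _ _ _ _ Hw Hvw _ _ ltac:(eauto))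
      as (u1 & u2 & [(-> & -> & Ha)|(-> & -> & Ha)]);
    inversion Hvw; subst; destruct (rel_closed_nil _ _ _ _ Ha);
    [apply codec_inl|apply codec_inr]; eauto.
  - conv_args Hc.
    destruct (atom_nil _ _ _ _ _ _ H0 eq_refl ltac:(eassumption)).
    destruct (canon_mu _ _ _ _ _ Hw Hvw k F [] ltac:(auto)) as (u1 & u2 & -> & -> & Ha).
    inversion Hvw; subst; destruct (rel_closed_nil _ _ _ _ Ha).
    apply codec_fold; eauto.
Qed.

(** * Related states and the simulation of client steps *)

(** The second clause makes the pairing of locations a partial bijection with one type per pair, so
    that a store leaves the other pairs intact. The third provides a fresh location when the ideal
    program allocates. *)
Definition heaps (W : world) (m1 m2 : nat -> option expr) : Prop :=
  (forall l1 l2 t, In (l1, l2, t) (fst W) ->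
     exists v1 v2, m1 l1 = Some v1 /\ m2 l2 = Some v2 /\ is_val v1 /\ rel W [] v1 v2 t) /\
  (forall l1 l2 t l1' l2' t', In (l1, l2, t) (fst W) -> In (l1', l2', t') (fst W) ->
     l1 = l1' \/ l2 = l2' -> l1 = l1' /\ l2 = l2' /\ t = t') /\
  (exists N, forall n, N <= n -> m2 n = None).

(** The ideal history is left free: the ideal [auth] and [unauth] hash nothing, so the two histories
    differ. *)
Definition state_rel (W : world) (s1 s2 : state I) : Prop :=
  st_hist s1 = snd W /\ st_idx s1 = i /\ st_idx s2 = i /\ heaps W (st_heap s1) (st_heap s2).

Lemma wle_refl W : wle W W.
Proof. split; apply incl_refl. Qed.
#[local] Hint Resolve wle_refl : core.

Lemma steps_refl e s : steps hashf (e, s) (e, s).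
Proof. constructor. Qed.
#[local] Hint Resolve steps_refl : core.

Lemma steps_trans a b c : steps hashf a b -> steps hashf b c -> steps hashf a c.
Proof. induction 1; auto. intros; econstructor; eauto. apply IHclos_refl_trans_1n; auto. Qed.

Lemma steps_ctx K e s e' s' : item_ok K -> steps hashf (e, s) (e', s') ->
  steps hashf (fill_item K e, s) (fill_item K e', s').
Proof.
  intros Hok H. remember (e', s') as c' eqn:Ec'.
  assert (Hc : forall c, steps hashf c c' ->
    steps hashf (fill_item K (fst c), snd c) (fill_item K (fst c'), snd c')).
  { clear H Ec'; induction 1 as [c1|c1 c2 c3 Hs H IH]; [constructor|].
    econstructor; [|exact IH]. apply PS_ctx; auto. }
  specialize (Hc _ H). subst; auto.
Qed.

Lemma steps_prim e s e' s' : prim_step hashf e s e' s' -> steps hashf (e, s) (e', s').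
Proof. intros H; apply Relation_Operators.rt1n_trans with (e', s'); [exact H|apply steps_refl]. Qed.

Lemma psteps_steps e e' s : psteps e e' -> steps hashf (e, s) (e', s).
Proof.
  induction 1; [apply steps_refl|]. eapply steps_trans; [|eassumption].
  apply steps_prim, pstep_prim; auto.
Qed.

Definition sim_result W e2 s2 e1' s1' t : Prop :=
  exists W' e2' s2', wle W W' /\ steps hashf (e2, s2) (e2', s2') /\
    rel W' [] e1' e2' t /\ state_rel W' s1' s2'.

Lemma sim_pure W e1 e2 e1' e1'' e2' s1 s2 s1' t :
  prim_step hashf e1 s1 e1'' s1' -> state_rel W s1 s2 ->
  phead e1 e1' -> phead e2 e2' -> rel W [] e1' e2' t -> sim_result W e2 s2 e1'' s1' t.
Proof.
  intros Hs HS H1 H2 HR.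
  destruct (pstep_det hashf _ _ (pstep_head _ _ H1) _ _ _ Hs) as [-> ->].
  exists W, e2', s2; split; [|split; [|split]]; auto.
  apply psteps_steps, psteps_one; auto.
Qed.

Lemma sim_ctx W e1 e2 e1' K1 K2 s1 s2 s1' t t' :
  item_ok K1 -> item_ok K2 -> ~ is_val e1 ->
  prim_step hashf (fill_item K1 e1) s1 e1' s1' ->
  (forall e0, prim_step hashf e1 s1 e0 s1' -> sim_result W e2 s2 e0 s1' t) ->
  (forall W' e0 e0', wle W W' -> rel W' [] e0 e0' t -> rel W' [] (fill_item K1 e0) (fill_item K2 e0') t') ->
  sim_result W (fill_item K2 e2) s2 e1' s1' t'.
Proof.
  intros Hk1 Hk2 Hv Hs IH HR.
  destruct (fill_step_inv _ _ _ _ _ _ Hk1 Hv Hs) as (e0 & -> & Hs').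
  destruct (IH _ Hs') as (W' & e2' & s2' & HW & Hst & HR' & HS).
  exists W', (fill_item K2 e2'), s2'; split; [|split; [|split]]; auto using steps_ctx.
Qed.

Ltac ctx_case K1 K2 e :=
  destruct (is_val_dec e);
  [|match goal with Hs : prim_step _ ?e1 _ _ _ |- sim_result _ ?e2 _ _ _ _ =>
      change e1 with (fill_item K1 e) in Hs;
      match goal with IH : forall s1 s2 e1' s1', _ -> prim_step _ e _ _ _ -> _ |- _ =>
      eapply (sim_ctx _ _ _ _ K1 K2); [| | |exact Hs|intros; eapply IH; eauto|]; simpl;
       eauto using rel_is_val;
       intros; rel_con; eauto using rel_mono
      end
    end].

Lemma un_op_sim W op t1 t v1 v2 v : un_op_typed op t1 t -> is_val v1 ->
  rel W [] v1 v2 (er t1) -> un_op_eval op v1 = Some v -> v2 = v1 /\ rel W [] v v (er t).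
Proof.
  intros Ht Hv HR He.
  destruct Ht;
  [destruct (canon_bool _ _ _ _ _ HR Hv (conv_refl _)) as (? & -> & ->)
  |destruct (canon_int _ _ _ _ _ HR Hv (conv_refl _)) as (? & -> & ->)
  |destruct (canon_string _ _ _ _ _ HR Hv (conv_refl _)) as (? & -> & ->)
  |destruct (canon_int _ _ _ _ _ HR Hv (conv_refl _)) as (? & -> & ->)
  |destruct (canon_string _ _ _ _ _ HR Hv (conv_refl _)) as (? & -> & ->)];
  simpl in He; injection He as <-; split; auto; try constructor.
  destruct (string_to_int _); repeat constructor.
Qed.

Lemma bin_op_sim W op t1 t2 t a1 a2 b1 b2 v : bin_op_typed op t1 t2 t -> is_val a1 -> is_val b1 ->
  rel W [] a1 a2 (er t1) -> rel W [] b1 b2 (er t2) -> bin_op_eval op a1 b1 = Some v ->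
  a2 = a1 /\ b2 = b1 /\ rel W [] v v (er t).
Proof.
  intros Ht Ha Hb HRa HRb He.
  destruct Ht;
  repeat match goal with
  | HR : rel _ _ ?e _ (er tbool), Hv : is_val ?e |- _ =>
     destruct (canon_bool _ _ _ _ _ HR Hv (conv_refl _)) as (? & -> & ->); clear HR Hv
  | HR : rel _ _ ?e _ (er tint), Hv : is_val ?e |- _ =>
     destruct (canon_int _ _ _ _ _ HR Hv (conv_refl _)) as (? & -> & ->); clear HR Hv
  | HR : rel _ _ ?e _ (er tstring), Hv : is_val ?e |- _ =>
     destruct (canon_string _ _ _ _ _ HR Hv (conv_refl _)) as (? & -> & ->); clear HR Hv
  end; simpl in He; injection He as <-; repeat split; auto; constructor.
Qed.

Lemma heaps_mono W W' m1 m2 : fst W' = fst W -> incl (snd W) (snd W') ->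
  heaps W m1 m2 -> heaps W' m1 m2.
Proof.
  intros E Hi (H1 & H2 & H3); unfold heaps; rewrite E; split; [|split]; auto.
  - intros l1 l2 t Hl. destruct (H1 l1 l2 t) as (v1 & v2 & ? & ? & ? & ?); auto.
    exists v1, v2; repeat split; auto. eapply rel_mono; [|eassumption].
    split; auto. rewrite E; apply incl_refl.
Qed.

Lemma heaps_alloc W m1 m2 v1 v2 t l1 l2 : is_val v1 -> rel W [] v1 v2 t ->
  m1 l1 = None -> m2 l2 = None -> heaps W m1 m2 ->
  heaps ((l1, l2, t) :: fst W, snd W) (heap_upd m1 l1 v1) (heap_upd m2 l2 v2).
Proof.
  intros Hv HR E1 E2 (H1 & H2 & H3).
  assert (HW : wle W ((l1, l2, t) :: fst W, snd W)).
  { split; simpl; [apply incl_tl|]; apply incl_refl. }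
  (* Every paired location is allocated, hence a fresh one belongs to no pair. *)
  assert (Hf : forall k1 k2 u, In (k1, k2, u) (fst W) -> k1 <> l1 /\ k2 <> l2).
  { intros k1 k2 u Hk. destruct (H1 _ _ _ Hk) as (w1 & w2 & ? & ? & _). split; congruence. }
  split; [|split].
  - intros k1 k2 u [Hk|Hk]; unfold heap_upd.
    + injection Hk as -> -> ->. exists v1, v2. rewrite !Nat.eqb_refl.
      repeat split; auto. eapply rel_mono; eauto.
    + destruct (Hf _ _ _ Hk) as [N1 N2]. apply Nat.eqb_neq in N1, N2. rewrite N1, N2.
      destruct (H1 _ _ _ Hk) as (w1 & w2 & ? & ? & ? & ?).
      exists w1, w2; repeat split; auto. eapply rel_mono; eauto.
  - simpl. intros k1 k2 u k1' k2' u' [Hk|Hk] [Hk'|Hk'] Heq.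
    + injection Hk as <- <- <-; injection Hk' as <- <- <-; auto.
    + injection Hk as <- <- <-. destruct (Hf _ _ _ Hk'). intuition congruence.
    + injection Hk' as <- <- <-. destruct (Hf _ _ _ Hk). intuition congruence.
    + eapply H2; eauto.
  - destruct H3 as (N & HN). exists (Nat.max N (S l2)). intros n Hn. unfold heap_upd.
    destruct (Nat.eqb_spec n l2); [lia|]. apply HN; lia.
Qed.

Lemma heaps_store W m1 m2 v1 v2 t l1 l2 : is_val v1 -> rel W [] v1 v2 t ->
  In (l1, l2, t) (fst W) -> heaps W m1 m2 ->
  heaps W (heap_upd m1 l1 v1) (heap_upd m2 l2 v2).
Proof.
  intros Hv HR Hl (H1 & H2 & H3).
  split; [|split; auto].
  - intros k1 k2 u Hk; unfold heap_upd.
    (* By the partial bijection, [k1] and [k2] are either both written or both untouched; the mixed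
       cases are contradictory. *)
    destruct (Nat.eqb_spec k1 l1), (Nat.eqb_spec k2 l2); subst.
    + edestruct (H2 _ _ _ _ _ _ Hl Hk) as (_ & _ & <-); eauto 6.
    + edestruct (H2 _ _ _ _ _ _ Hl Hk) as (_ & <- & _); eauto; congruence.
    + edestruct (H2 _ _ _ _ _ _ Hl Hk) as (<- & _ & _); eauto; congruence.
    + auto.
  - destruct H3 as (N & HN). destruct (H1 _ _ _ Hl) as (w1 & w2 & _ & E & _).
    exists N. intros n Hn. unfold heap_upd.
    destruct (Nat.eqb_spec n l2); subst; auto. rewrite HN in E; congruence.
Qed.

(** Subject reduction on pairs of terms. No rule of [rel] applies a value of type [uM], so no proof
    element is checked here; collision freedom enters with [sim_mrel]. *)
Lemma sim_rel W G e1 e2 t : rel W G e1 e2 t -> G = [] -> forall s1 s2 e1' s1',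
  state_rel W s1 s2 -> prim_step hashf e1 s1 e1' s1' -> sim_result W e2 s2 e1' s1' t.
Proof.
  induction 1; intros HG; subst;
    repeat match goal with H : [] = [] -> _ |- _ => specialize (H eq_refl) end;
    intros s1 s2 e1' s1' HS Hs;
    try (exfalso; refine (val_no_step _ _ _ _ _ Hs _); auto; unfold retV, bindVb, unauthF,
        unauthVb, evi_stringV, evi_intV, pairV, sumV, muV,
        ser_str, parse_str, ser_int, parse_int; auto; fail).
  - discriminate.
  - ctx_case (AppLCtx b1) (AppLCtx b2) a1.
    ctx_case (AppRCtx a1) (AppRCtx a2) b1.
    assert (Hb2 := rel_is_val _ _ _ _ _ H0 H2).
    destruct (canon_arrow _ _ _ _ _ H H1 _ _ (conv_refl _)) as
      [(f & x & c1 & c2 & a' & b' & -> & -> & Ha & Hb & Hc)|(E & E' & a' & -> & -> & HE & HRE & Ha & Hb)].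
    + eapply sim_pure; [exact Hs|exact HS|constructor; auto|constructor; auto|].
      eapply rel_Conv; [|exact Hb].
      eapply rel_subst_cons; auto; [eapply rel_subst_cons; eauto using rel_weaken_nil, rel_Conv|].
      constructor; auto.
    + destruct (atom_nil _ _ _ _ _ _ HRE eq_refl HE) as [HEv HEc].
      destruct (rel_closed_nil _ _ _ _ H0) as [Hc1 Hc2].
      eapply sim_pure; [exact Hs|exact HS|constructor; auto|constructor; auto|].
      eapply rel_Conv; [|exact Hb].
      replace (subst "" _ _) with (unauthVb E b1).
      2: { simpl; eqb_const. rewrite ?(subst_closed _ _ E), ?(subst_closed _ _ b1) by auto. reflexivity. }
      replace (subst "" _ _) with (thunkI b2).
      2: { simpl; eqb_const. rewrite ?(subst_closed _ _ b2) by auto. reflexivity. }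
      eapply rel_unauth; eauto using rel_Conv; left; auto.
  - ctx_case (UnOpCtx op) (UnOpCtx op) e1.
    inv_head Hs.
    destruct (un_op_sim _ _ _ _ _ _ _ H ltac:(eassumption) ltac:(eassumption) ltac:(eassumption)) as [-> HR].
    eapply sim_pure; [exact Hs|exact HS|constructor; eauto|constructor; eauto|auto].
  - ctx_case (BinOpLCtx op b1) (BinOpLCtx op b2) a1.
    ctx_case (BinOpRCtx op a1) (BinOpRCtx op a2) b1.
    inv_head Hs.
    destruct (bin_op_sim _ _ _ _ _ _ _ _ _ _ H H2 H3 H0 H1 ltac:(eassumption)) as (-> & -> & HR).
    eapply sim_pure; [exact Hs|exact HS|constructor; eauto|constructor; eauto|auto].
  - ctx_case (IfCtx b1 c1) (IfCtx b2 c2) a1.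
    destruct (canon_bool _ _ _ _ _ H ltac:(auto) (conv_refl _)) as (b & -> & ->).
    eapply sim_pure; [exact Hs|exact HS|constructor|constructor|destruct b; auto].
  - ctx_case (PairLCtx b1) (PairLCtx b2) a1.
    ctx_case (PairRCtx a1) (PairRCtx a2) b1.
    exfalso; eapply val_no_step; eauto.
  - ctx_case FstCtx FstCtx e1.
    destruct (canon_prod _ _ _ _ _ H ltac:(auto) _ _ (conv_refl _))
      as (a1 & b1 & a2 & b2 & -> & -> & Ha & Hb).
    match goal with Hv : is_val _ |- _ => inversion Hv; subst end.
    eapply sim_pure; [exact Hs|exact HS|constructor; auto|constructor; eauto using rel_is_val|auto].
  - ctx_case SndCtx SndCtx e1.
    destruct (canon_prod _ _ _ _ _ H ltac:(auto) _ _ (conv_refl _))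
      as (a1 & b1 & a2 & b2 & -> & -> & Ha & Hb).
    match goal with Hv : is_val _ |- _ => inversion Hv; subst end.
    eapply sim_pure; [exact Hs|exact HS|constructor; auto|constructor; eauto using rel_is_val|auto].
  - ctx_case InjLCtx InjLCtx e1. exfalso; eapply val_no_step; eauto.
  - ctx_case InjRCtx InjRCtx e1. exfalso; eapply val_no_step; eauto.
  - ctx_case (CaseCtx x b1 y c1) (CaseCtx x b2 y c2) a1.
    destruct (canon_sum _ _ _ _ _ H ltac:(auto) _ _ (conv_refl _))
      as (v1 & v2 & [(-> & -> & Ha)|(-> & -> & Ha)]);
    match goal with Hv : is_val _ |- _ => inversion Hv; subst end;
    (eapply sim_pure; [exact Hs|exact HS|constructor; auto|constructor; eauto using rel_is_val|]);
    eapply rel_subst_cons; eauto using rel_is_val.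
  - ctx_case TInstCtx TInstCtx e1.
    destruct (canon_forall _ _ _ _ _ H ltac:(auto) _ _ (conv_refl _))
      as (b1 & b2 & -> & -> & Hb).
    eapply sim_pure; [exact Hs|exact HS|constructor; auto|constructor; auto|auto].
  - ctx_case PackCtx PackCtx e1. exfalso; eapply val_no_step; eauto.
  - ctx_case (UnpackCtx x b1) (UnpackCtx x b2) e1.
    destruct (canon_exists _ _ _ _ _ H ltac:(auto) _ _ (conv_refl _))
      as (v1 & v2 & s & -> & -> & Hb).
    match goal with Hv : is_val _ |- _ => inversion Hv; subst end.
    eapply sim_pure; [exact Hs|exact HS|constructor; auto|constructor; eauto using rel_is_val|].
    eapply rel_subst_cons; eauto using rel_is_val.
  - ctx_case FoldCtx FoldCtx e1. exfalso; eapply val_no_step; eauto.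
  - ctx_case UnfoldCtx UnfoldCtx e1.
    destruct (canon_mu _ _ _ _ _ H ltac:(auto) _ _ _ (conv_refl _)) as (v1 & v2 & -> & -> & Hb).
    match goal with Hv : is_val _ |- _ => inversion Hv; subst end.
    eapply sim_pure; [exact Hs|exact HS|constructor; auto|constructor; eauto using rel_is_val|auto].
  - ctx_case AllocCtx AllocCtx e1.
    inv_head Hs. destruct HS as (E1 & E2 & E3 & HH); simpl in *.
    destruct s2 as [m2 h2 i2]; simpl in *. destruct (proj2 (proj2 HH)) as (N & HN).
    (* The ideal program allocates at the bound [N], from which on its heap is empty; [l] is the
       location picked by the verifier. *)
    exists ((l, N, t) :: fst W, snd W), (Loc N), (mkState (heap_upd m2 N e2) h2 i2).
    split; [|split; [|split]].
    + split; simpl; [apply incl_tl|]; apply incl_refl.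
    + apply steps_prim, PS_head. constructor; eauto using rel_is_val.
    + constructor; left; auto.
    + split; [|split; [|split]]; auto. apply heaps_alloc; auto.
  - ctx_case DerefCtx DerefCtx e1.
    destruct (canon_ref _ _ _ _ _ H ltac:(auto) _ (conv_refl _)) as (l1 & l2 & a' & -> & -> & Hl & Hc).
    inv_head Hs. destruct HS as (E1 & E2 & E3 & HH).
    destruct (proj1 HH _ _ _ Hl) as (v1 & v2 & Hv1 & Hv2 & Hv & HR).
    exists W, v2, s2; split; [|split; [|split]]; auto.
    + apply steps_prim, PS_head. constructor; auto.
    + eapply rel_Conv; [|exact Hc]. congruence.
    + split; auto.
  - ctx_case (StoreLCtx b1) (StoreLCtx b2) a1.
    ctx_case (StoreRCtx a1) (StoreRCtx a2) b1.
    destruct (canon_ref _ _ _ _ _ H ltac:(auto) _ (conv_refl _)) as (l1 & l2 & a' & -> & -> & Hl & Hc).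
    inv_head Hs. destruct HS as (E1 & E2 & E3 & HH); simpl in *.
    destruct (proj1 HH _ _ _ Hl) as (v1 & v2 & Hv1 & Hv2 & Hv & HR).
    destruct s2 as [m2 h2 i2]; simpl in *.
    exists W, Unit, (mkState (heap_upd m2 l2 b2) h2 i2); split; [|split; [|split]]; auto.
    + apply steps_prim, PS_head. econstructor; eauto using rel_is_val.
    + constructor.
    + split; [|split; [|split]]; auto. apply (heaps_store _ _ _ _ _ a'); auto. eapply rel_Conv; eauto.
  - ctx_case HashCtx HashCtx e1.
    destruct (canon_string _ _ _ _ _ H ltac:(auto) (conv_refl _)) as (s & -> & ->).
    inv_head Hs. destruct HS as (E1 & E2 & E3 & HH); simpl in *.
    destruct s2 as [m2 h2 i2]; simpl in *; subst.
    exists (fst W, s :: snd W), (Lit (LStr (hashf i s))), (mkState m2 (s :: h2) i).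
    assert (wle W (fst W, s :: snd W)).
    { split; simpl; [|apply incl_tl]; apply incl_refl. }
    split; [|split; [|split]]; auto.
    + apply steps_prim, PS_head. constructor.
    + constructor.
    + split; [|split; [|split]]; auto. simpl. eapply heaps_mono; [| |exact HH]; auto. apply H1.
  - destruct (IHrel _ _ _ _ HS Hs) as (W' & e2' & s2' & ? & ? & ? & ?).
    exists W', e2', s2'; split; [|split; [|split]]; eauto using rel_Conv.
  (* [auth] starts to serialize. By [rel_evi_codec] the call evaluates purely to [Str (ser x)], so
     the step taken is the first one of that evaluation and [rel_authrun] holds of the remainder,
     while the ideal side waits. *)
  - destruct (atom_nil _ _ _ _ _ _ H eq_refl H1) as [HEv HEc].
    destruct (atom_nil _ _ _ _ _ _ H0 eq_refl H2) as [Hxv Hxc].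
    destruct (rel_evi_codec _ _ _ _ _ H eq_refl HEv _ (conv_refl _) _ _ _ H0 Hxv) as [Hser _].
    change (Hash (App (Fst E) x)) with (fill_item HashCtx (App (Fst E) x)) in Hs.
    apply fill_step_inv in Hs as (z & -> & Hs); simpl; auto; [|intros Hv; inversion Hv].
    apply ev_psteps in Hser. inversion Hser as [|z' ? Hz Hz']; subst.
    destruct (pstep_det hashf _ _ Hz _ _ _ Hs) as [-> ->].
    exists W, y, s2; split; [|split; [|split]]; auto.
    eapply rel_authrun; eauto using rel_is_val. eapply pstep_closed; eauto.
    simpl. rewrite HEc; auto.
  (* Either the string is complete, and hashing it enters [ser v1] into the history as [rel_authv]
     demands, or serialization goes on by one pure step. *)
  - inversion H0 as [|z' ? Hz Hz']; subst.
    + inv_head Hs. destruct HS as (E1 & E2 & E3 & HH); simpl in *; subst.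
      exists (fst W, ser v1 :: snd W), v2, s2.
      assert (wle W (fst W, ser v1 :: snd W)).
      { split; simpl; [|apply incl_tl]; apply incl_refl. }
      split; [|split; [|split]]; auto.
      * apply rel_authv; eauto using rel_mono. left; auto.
      * split; [|split; [|split]]; auto. simpl. eapply heaps_mono; [| |exact HH]; auto. apply H4.
    + change (Hash z) with (fill_item HashCtx z) in Hs.
      apply fill_step_inv in Hs as (z0 & -> & Hs); simpl; auto.
      * destruct (pstep_det hashf _ _ Hz _ _ _ Hs) as [-> ->].
        exists W, v2, s2; split; [|split; [|split]]; auto.
        eapply rel_authrun; eauto using pstep_closed.
      * intros Hv. eapply val_no_step; [|exact Hv]. eapply (pstep_prim hashf _ _ s1); eauto.
Qed.

(** * The theorem *)

Definition sctx (d : nat -> uty) (G : tctx) : uctx :=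
  map (fun p => (fst p, usubst d (er (snd p)))) G.

Lemma ulookup_sctx d G x t : lookup G x = Some t -> ulookup (sctx d G) x = Some (usubst d (er t)).
Proof.
  induction G as [|[y u] G IH]; simpl; [discriminate|].
  destruct (String.eqb x y); auto. intros E; injection E as ->; auto.
Qed.

Lemma sctx_lift s d G : sctx (scons s d) (lift_ctx G) = sctx d G.
Proof.
  unfold sctx, lift_ctx. rewrite map_map. apply map_ext. intros [x t]; simpl.
  rewrite er_tlift_1, usubst_shift; auto.
Qed.

Lemma er_tapps args : forall t, er (tapps t args) = uapps (er t) (map er args).
Proof. induction args; simpl; intros; [|rewrite IHargs]; auto. Qed.

Lemma usubst_uapps d args : forall t, usubst d (uapps t args) = uapps (usubst d t) (map (usubst d) args).
Proof. induction args; simpl; intros; [|rewrite IHargs]; auto. Qed.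

Lemma un_op_typed_closed op t1 t d : un_op_typed op t1 t ->
  usubst d (er t1) = er t1 /\ usubst d (er t) = er t.
Proof. destruct 1; auto. Qed.

Lemma bin_op_typed_closed op t1 t2 t d : bin_op_typed op t1 t2 t ->
  usubst d (er t1) = er t1 /\ usubst d (er t2) = er t2 /\ usubst d (er t) = er t.
Proof. destruct 1; auto. Qed.

(** Typable source code contains neither locations nor library values, so it is related to itself in
    every world. The substitution [d] is arbitrary because [rel_TAbs] and [rel_Unpack] ask for all
    types; at these binders it is extended to [scons s d]. *)
Lemma fundamental W Th G e t : typed Th G e t ->
  forall d, rel W (sctx d G) e e (usubst d (er t)).
Proof.
  induction 1; intros d.
  - constructor; apply ulookup_sctx; auto.
  - constructor.
  - constructor.
  - constructor.
  - constructor.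
  - apply rel_Rec. apply IHtyped.
  - eapply rel_App; [apply IHtyped1|apply IHtyped2].
  - specialize (IHtyped d).
    destruct (un_op_typed_closed _ _ _ d H) as [E1 E2]. rewrite E1 in IHtyped; rewrite E2.
    eapply rel_UnOp; eauto.
  - specialize (IHtyped1 d); specialize (IHtyped2 d).
    destruct (bin_op_typed_closed _ _ _ _ d H) as (E1 & E2 & E3).
    rewrite E1 in IHtyped1; rewrite E2 in IHtyped2; rewrite E3. eapply rel_BinOp; eauto.
  - eapply rel_If; [apply IHtyped1|apply IHtyped2|apply IHtyped3].
  - apply rel_Pair; auto.
  - eapply rel_Fst; apply IHtyped.
  - eapply rel_Snd; apply IHtyped.
  - apply rel_InjL; auto.
  - apply rel_InjR; auto.
  - eapply rel_Case; [apply IHtyped1|apply IHtyped2|apply IHtyped3].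
  - apply rel_TAbs. intros s. eapply rel_Conv; [|apply conv_sym, conv_beta].
    rewrite usubst_up_beta, <- (sctx_lift s). apply IHtyped.
  - eapply rel_TInst; apply IHtyped.
  - eapply rel_Pack; apply IHtyped.
  - eapply rel_Unpack; [apply IHtyped1|]. intros s.
    (* The result type and [G] are lifted, so [scons s d] acts on them as [d]; only the type of the
       unpacked variable sees [s]. *)
    specialize (IHtyped2 (scons s d)). simpl in IHtyped2.
    rewrite !er_tlift_1, !usubst_shift in IHtyped2. fold (sctx (scons s d)) in IHtyped2.
    change (map _ (lift_ctx G)) with (sctx (scons s d) (lift_ctx G)) in IHtyped2.
    rewrite sctx_lift in IHtyped2. exact IHtyped2.
  - specialize (IHtyped d). rewrite er_tapps, usubst_uapps in *. apply rel_Fold. exact IHtyped.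
  - specialize (IHtyped d). rewrite er_tapps, usubst_uapps in *. eapply rel_Unfold. exact IHtyped.
  - apply rel_Alloc; auto.
  - eapply rel_Deref; apply IHtyped.
  - eapply rel_Store; [apply IHtyped1|apply IHtyped2].
  - apply rel_Hash; apply IHtyped.
  - eapply rel_Conv; [apply IHtyped|]. apply conv_usubst, ty_equiv_conv; auto.
Qed.

Ltac inst := let s := fresh "s" in
  apply rel_TAbs; intros s; eapply rel_Conv; [|apply conv_sym, conv_beta]; simpl;
  rewrite ?usubst_beta_shift.

Ltac at_var := right; eexists; split; [reflexivity|simpl; tauto].

(** Once [auth], [m] and [evi] are the constants, each component has the type of a rule of [rel]
    made for it. The parameters of the library functions are variables here, which is the second
    alternative of [atom]. *)
Lemma Authentikit_related W :
  rel W [] AuthentikitV AuthentikitI (UApp (UApp (er AuthentikitFunc) (UC UAuth)) (UC UM)).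
Proof.
  eapply rel_Conv; [|apply conv_sym; eapply conv_trans;
    [apply conv_app; [apply conv_beta|apply conv_refl]|apply conv_beta]].
  simpl. apply rel_Pair; [|apply rel_Pair].
  - inst. apply rel_Rec. apply rel_ret; try at_var. constructor; reflexivity.
  - inst. inst. apply rel_Rec, rel_Rec. eapply rel_bind; try at_var; constructor; reflexivity.
  - apply rel_Pack with (s := UC UEvi). eapply rel_Conv; [|apply conv_sym, conv_beta]. simpl.
    repeat apply rel_Pair.
    + inst. apply rel_eviauth.
    + inst. inst. apply rel_Rec, rel_Rec.
      eapply rel_evipair; try at_var; constructor; reflexivity.
    + inst. inst. apply rel_Rec, rel_Rec.
      eapply rel_evisum; try at_var; constructor; reflexivity.
    + apply rel_evistr.
    + apply rel_eviint.
    + inst. apply rel_Rec. eapply rel_evimu; try at_var; constructor; reflexivity.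
    + inst. apply rel_Rec, rel_Rec. eapply rel_auth; try at_var; constructor; reflexivity.
    + inst. apply rel_Rec. eapply rel_unauthf; try at_var; constructor; reflexivity.
Qed.

Lemma er_primitive tau : primitive_ty tau -> forall d,
  usubst d (er tau) = er tau /\ er (tlift 2 0 tau) = er tau.
Proof.
  induction 1; intros d; simpl; auto;
    destruct (IHprimitive_ty1 d) as [E1 E2], (IHprimitive_ty2 d) as [E3 E4];
    rewrite E1, E2, E3, E4; auto.
Qed.

Lemma client_related W tau e : primitive_ty tau -> typed [] [] e (client_ty tau) ->
  rel W [] (App (TInst (TInst e)) AuthentikitV) (App (TInst (TInst e)) AuthentikitI) (uM (er tau)).
Proof.
  intros Hp Ht. eapply rel_App; [|apply Authentikit_related].
  assert (HR := fundamental W _ _ _ _ Ht UVar). rewrite usubst_UVar in HR.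
  change (er (client_ty tau)) with
    (UApp (uK (CForall KF)) (ULam (UApp (uK (CForall KF)) (ULam
       (uarrow (UApp (UApp (er AuthentikitFunc) (UVar 1)) (UVar 0))
               (UApp (UVar 0) (er (tlift 2 0 tau)))))))) in HR.
  rewrite (proj2 (er_primitive tau Hp UVar)) in HR.
  assert (E := fun d => proj1 (er_primitive tau Hp d)). revert HR E.
  (* [er tau] is made opaque: [cbn] then computes the two instantiations around it, and [E] removes
     the substitutions left on it. *)
  generalize (er tau) as t. intros t HR E.
  apply rel_TInst with (s := UC UAuth) in HR.
  eapply rel_Conv in HR; [|apply conv_beta].
  apply rel_TInst with (s := UC UM) in HR.
  eapply rel_Conv in HR; [|apply conv_beta].
  cbn in HR. rewrite !E in HR. exact HR.
Qed.

(** None of the constants [UAuth], [UM], [UEvi] occurs in a primitive type, so the canonical forms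
    agree down to the literals. *)
Lemma primitive_eq W tau v1 v2 : primitive_ty tau -> is_val v1 -> rel W [] v1 v2 (er tau) -> v1 = v2.
Proof.
  intros Hp; revert v1 v2; induction Hp; intros v1 v2 Hv HR; simpl in HR.
  - destruct (canon_unit _ _ _ _ _ HR Hv (conv_refl _)) as (-> & ->); auto.
  - destruct (canon_bool _ _ _ _ _ HR Hv (conv_refl _)) as (? & -> & ->); auto.
  - destruct (canon_int _ _ _ _ _ HR Hv (conv_refl _)) as (? & -> & ->); auto.
  - destruct (canon_string _ _ _ _ _ HR Hv (conv_refl _)) as (? & -> & ->); auto.
  - destruct (canon_prod _ _ _ _ _ HR Hv _ _ (conv_refl _)) as (? & ? & ? & ? & -> & -> & ? & ?).
    inversion Hv; subst. f_equal; auto.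
  - destruct (canon_sum _ _ _ _ _ HR Hv _ _ (conv_refl _)) as (? & ? & [(-> & -> & ?)|(-> & -> & ?)]);
      inversion Hv; subst; f_equal; auto.
Qed.

(** * Execution of computations on a proof *)

Lemma proof_val_val p : is_val (proof_val p).
Proof. induction p; simpl; auto 6. Qed.
#[local] Hint Resolve proof_val_val : core.

Lemma proof_val_closed p : closedb [] (proof_val p) = true.
Proof. induction p; simpl; auto. Qed.

(** [unauth] just before it hashes the proof element, its only impure step. The code that extracts
    the element and the code after the hash are pure and fall under [mrel_pure]; on the ideal side
    the result is already there. *)
Definition unauthRun (E : expr) (s h : string) (ps : list string) : expr :=
  If (EqE (Hash (Str s)) (Str h))
    (MatchOpt (App (Snd E) (Str s)) ENone "r"
       (If (EqE (Snd (Var "r")) (Str ""))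
           (ESome (Pair (Snd (Pair (Str s) (proof_val ps))) (Fst (Var "r")))) ENone))
    ENone.

Definition bindRun (f : expr) (e : expr) : expr :=
  MatchOpt e ENone "r" (App2 f (Snd (Var "r")) (Fst (Var "r"))).

(* A failed verifier run is related to anything. *)
Inductive mrel (W : world) : expr -> expr -> uty -> Prop :=
| mrel_app c1 c2 pe p a :
    rel W [] c1 c2 (uM a) -> psteps pe (proof_val p) -> mrel W (App c1 pe) (App c2 Unit) a
| mrel_bind e1 e2 f1 f2 a b :
    mrel W e1 e2 a -> is_val f1 -> rel W [] f1 f2 (uarrow a (uM b)) ->
    mrel W (bindRun f1 e1) (App2 f2 e2 Unit) b
| mrel_ret p v1 v2 a : is_val v1 -> rel W [] v1 v2 a -> mrel W (ESome (Pair (proof_val p) v1)) v2 a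
| mrel_fail e2 a : mrel W ENone e2 a
| mrel_pure e1 e1' e2 a : psteps e1 e1' -> mrel W e1' e2 a -> mrel W e1 e2 a
| mrel_unauth E E' s h v2 ps a :
    is_val E -> rel W [] E E' (uevi a) -> rel W [] (Str h) v2 (uauth a) ->
    mrel W (unauthRun E s h ps) v2 a.

Lemma mrel_val W e1 e2 a : mrel W e1 e2 a -> is_val e1 ->
  e1 = ENone \/ exists p v1, e1 = ESome (Pair (proof_val p) v1) /\ is_val v1 /\ rel W [] v1 e2 a.
Proof.
  induction 1; intros Hv; try (exfalso; inversion Hv; fail); auto.
  - right; eauto 6.
  - rewrite (psteps_val _ _ Hv H) in *. auto.
Qed.

Definition msim_result W e2 s2 e1' s1' a : Prop :=
  exists W' e2' s2', wle W W' /\ steps hashf (e2, s2) (e2', s2') /\ mrel W' e1' e2' a /\ state_rel W' s1' s2'.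

(** The accepting branch: [codec] is used with an empty rest, so the test that the whole string was
    consumed succeeds. *)
Lemma unauth_accept E v ps :
  is_val E -> closedb [] E = true -> is_val v -> closedb [] v = true -> codec E v ->
  ev (MatchOpt (App (Snd E) (Str (ser v))) ENone "r"
       (If (EqE (Snd (Var "r")) (Str ""))
           (ESome (Pair (Snd (Pair (Str (ser v)) (proof_val ps))) (Fst (Var "r")))) ENone))
     (ESome (Pair (proof_val ps) v)).
Proof.
  intros HE HEc Hv Hvc [_ D]. specialize (D ""). rewrite append_nil_r in D.
  eapply ev_caser; [exact D|]. simpl. eqb_const.
  rewrite (subst_closed _ _ (proof_val ps)) by apply proof_val_closed.
  eapply ev_if with (b := true).
  { eapply ev_binop; [eapply ev_snd, ev_val; auto|apply ev_val; auto|reflexivity]. }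
  apply ev_injr, ev_pair; [eapply ev_snd|eapply ev_fst]; apply ev_val; auto.
Qed.

(** The ideal program may move when client code moves, and it moves when a computation receives the
    proof; the other library steps of the verifier are answered by no step. *)
Lemma sim_mrel W e1 e2 a : mrel W e1 e2 a -> forall s1 s2 e1' s1',
  state_rel W s1 s2 -> prim_step hashf e1 s1 e1' s1' -> collision_free hashf s1' ->
  msim_result W e2 s2 e1' s1' a.
Proof.
  induction 1; intros s1 s2 e1'' s1' HS Hs Hcf.
  - destruct (is_val_dec c1) as [Hc|Hc].
    2: { apply (fill_step_inv hashf (AppLCtx pe)) in Hs as (c1' & -> & Hs); simpl; auto.
         destruct (sim_rel _ _ _ _ _ H eq_refl _ _ _ _ HS Hs) as (W' & c2' & s2' & HW & Hst & HR & HS').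
         exists W', (App c2' Unit), s2'; split; [|split; [|split]]; auto.
         - apply (steps_ctx (AppLCtx Unit)); simpl; auto.
         - eapply mrel_app; eauto. }
    destruct (is_val_dec pe) as [Hpe|Hpe].
    2: { inversion H0 as [|pe' ? Hp Hp']; subst; [exfalso; auto|].
         apply (fill_step_inv hashf (AppRCtx c1)) in Hs as (pe'' & -> & Hs); simpl; auto.
         destruct (pstep_det hashf _ _ Hp _ _ _ Hs) as [-> ->].
         exists W, (App c2 Unit), s2; split; [|split; [|split]]; auto using steps_refl.
         eapply mrel_app; eauto. }
    apply psteps_val in H0; auto; subst pe.
    assert (Hpc := proof_val_closed p).
    destruct (rel_closed_nil _ _ _ _ H) as [Hcl1 Hcl2].
    destruct (canon_m _ _ _ _ _ H Hc _ (conv_refl _)) as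
      [(x & y & -> & -> & Hx & Hy & HR)
      |[(d1 & d2 & f1 & f2 & b & -> & -> & Hd1 & Hd2 & Hf1 & Hf2 & HRd & HRf)
      |(E & E' & h & y & -> & -> & HE & Hh & Hy & HRE & HRh)]].
    + destruct (atom_nil _ _ _ _ _ _ HR eq_refl Hx) as [Hxv Hxc].
      destruct (rel_closed_nil _ _ _ _ HR) as [_ Hyc].
      destruct (pstep_det hashf _ _ (pstep_head _ _ (PH_Beta _ _ _ _ Hpe)) _ _ _ Hs) as [-> ->].
      exists W, y, s2; split; [|split; [|split]]; auto.
      * apply psteps_steps, psteps_one.
        replace y with (subst "" (thunkI y) (subst "u" Unit y)) at 2
          by (rewrite !(subst_closed _ _ y); auto).
        constructor; auto.
      * simpl. eqb_const.
        rewrite ?(subst_closed _ _ x), ?(subst_closed _ _ (proof_val p)) by auto.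
        apply mrel_ret; auto.
    + destruct (atom_nil _ _ _ _ _ _ HRd eq_refl Hd1) as [Hdv Hdc].
      destruct (atom_nil _ _ _ _ _ _ HRf eq_refl Hf1) as [Hfv Hfc].
      destruct (rel_closed_nil _ _ _ _ HRd) as [_ Hdc2].
      destruct (rel_closed_nil _ _ _ _ HRf) as [_ Hfc2].
      destruct (pstep_det hashf _ _ (pstep_head _ _ (PH_Beta _ _ _ _ Hpe)) _ _ _ Hs) as [-> ->].
      exists W, (bindIb d2 f2), s2; split; [|split; [|split]]; auto.
      * apply psteps_steps, psteps_one.
        replace (bindIb d2 f2) with
          (subst "" (thunkI (bindIb d2 f2)) (subst "u" Unit (bindIb d2 f2))) at 2
          by (simpl; rewrite !(subst_closed _ _ d2), !(subst_closed _ _ f2); auto).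
        constructor; auto.
      * simpl. eqb_const.
        rewrite ?(subst_closed _ _ d1), ?(subst_closed _ _ f1), ?(subst_closed _ _ (proof_val p)) by auto.
        apply (mrel_bind _ (App d1 (proof_val p)) (App d2 Unit) f1 f2 b); auto.
        eapply mrel_app; eauto. constructor.
    + destruct (atom_nil _ _ _ _ _ _ HRE eq_refl HE) as [HEv HEc].
      destruct (atom_nil _ _ _ _ _ _ HRh eq_refl Hh) as [Hhv Hhc].
      destruct (rel_closed_nil _ _ _ _ HRh) as [_ Hyc].
      destruct (pstep_det hashf _ _ (pstep_head _ _ (PH_Beta _ _ _ _ Hpe)) _ _ _ Hs) as [-> ->].
      exists W, y, s2; split; [|split; [|split]]; auto.
      * apply psteps_steps, psteps_one.
        replace y with (subst "" (thunkI y) (subst "u" Unit y)) at 2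
          by (rewrite !(subst_closed _ _ y); auto).
        constructor; auto.
      * destruct (canon_auth _ _ _ _ _ HRh Hhv _ (conv_refl _)) as (v1 & -> & _).
        simpl. eqb_const.
        rewrite ?(subst_closed _ _ E), ?(subst_closed _ _ (proof_val p)) by auto.
        (* An exhausted proof makes the verifier fail; otherwise pure steps lead to [unauthRun]. *)
        destruct p as [|s ps]; simpl.
        -- eapply mrel_pure; [|apply mrel_fail].
           apply ev_psteps. eapply ev_casel; [eapply ev_unfold, ev_val; auto|].
           simpl. apply ev_val; auto.
        -- eapply mrel_pure; [|apply (mrel_unauth _ E E' s (hf (ser v1)) y ps a); auto].
           eapply psteps_trans.
           { apply (psteps_ctx (CaseCtx _ _ _ _)); simpl; auto.
             apply psteps_one, PH_Unfold. auto. }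
           simpl. eapply psteps_trans; [apply psteps_one, PH_CaseR; auto|].
           simpl. eqb_const.
           rewrite ?(subst_closed _ _ E), ?(subst_closed _ _ (proof_val ps)) by auto using proof_val_closed.
           eapply psteps_trans.
           { apply (psteps_ctx (AppRCtx _)); simpl; auto.
             apply psteps_one, PH_Fst; auto. }
           simpl. eapply psteps_trans; [apply psteps_one, PH_Beta; auto|].
           simpl. eqb_const.
           rewrite ?(subst_closed _ _ E), ?(subst_closed _ _ (proof_val ps)) by auto using proof_val_closed.
           constructor.
  - destruct (rel_closed_nil _ _ _ _ H1) as [Hfc1 Hfc2].
    destruct (is_val_dec e1) as [He|He].
    2: { apply (fill_step_inv hashf (CaseCtx "_" ENone "r" _)) in Hs as (e0 & -> & Hs); simpl; auto.
         destruct (IHmrel _ _ _ _ HS Hs Hcf) as (W' & e2' & s2' & HW & Hst & HM & HS').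
         exists W', (App2 f2 e2' Unit), s2'; split; [|split; [|split]]; auto.
         - apply (steps_ctx (AppLCtx Unit)); simpl; auto.
           apply (steps_ctx (AppRCtx f2)); simpl; auto. eapply rel_is_val; eauto.
         - apply (mrel_bind _ e0 e2' f1 f2 a b); eauto using rel_mono. }
    destruct (mrel_val _ _ _ _ H He) as [->|(p & v1 & -> & Hv & HR)].
    + assert (Hst : pstep (bindRun f1 ENone) ENone)
        by (apply pstep_head; apply (PH_CaseL Unit "_" ENone); auto).
      destruct (pstep_det hashf _ _ Hst _ _ _ Hs) as [-> ->].
      exists W, (App2 f2 e2 Unit), s2; split; [|split; [|split]]; auto using steps_refl, mrel_fail.
    + destruct (rel_closed_nil _ _ _ _ HR) as [Hvc _].
      assert (Hst : pstep (bindRun f1 (ESome (Pair (proof_val p) v1)))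
        (App2 f1 (Snd (Pair (proof_val p) v1)) (Fst (Pair (proof_val p) v1)))).
      { apply pstep_head.
        replace (App2 f1 _ _) with (subst "r" (Pair (proof_val p) v1)
           (App2 f1 (Snd (Var "r")) (Fst (Var "r")))) at 1
          by (simpl; eqb_const; rewrite subst_closed; auto).
        apply PH_CaseR; auto. }
      destruct (pstep_det hashf _ _ Hst _ _ _ Hs) as [-> ->].
      exists W, (App2 f2 e2 Unit), s2; split; [|split; [|split]]; auto using steps_refl.
      eapply mrel_pure.
      { apply (psteps_ctx (AppLCtx _)); simpl; auto.
        apply (psteps_ctx (AppRCtx _)); simpl; auto.
        apply psteps_one, PH_Snd; auto. }
      (* Evaluation is left to right, so the projection [Fst] waits while [App f1 v1] runs to a
         computation; hence [mrel_app] admits an argument [pe] that only reduces to a proof. *)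
      simpl. apply (mrel_app _ (App f1 v1) (App f2 e2) _ p b).
      * eapply rel_App; eauto.
      * apply psteps_one, PH_Fst; auto.
  - exfalso; eapply val_no_step; eauto.
  - exfalso; eapply val_no_step; eauto.
  - inversion H as [|e0 ? Hp Hp']; subst; [eauto|].
    destruct (pstep_det hashf _ _ Hp _ _ _ Hs) as [-> ->].
    exists W, e2, s2; split; [|split; [|split]]; auto using steps_refl.
    eapply mrel_pure; eauto.
  - destruct (rel_closed_nil _ _ _ _ H0) as [HEc _].
    apply (fill_step_inv hashf (IfCtx _ _)) in Hs as (c & -> & Hs); simpl; auto;
      [|intros Hv; inversion Hv].
    apply (fill_step_inv hashf (BinOpLCtx EqOp _)) in Hs as (c' & -> & Hs); simpl; auto;
      [|intros Hv; inversion Hv].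
    simpl in Hs. inv_head Hs. destruct HS as (E1 & E2 & E3 & HH); simpl in *; subst.
    destruct (canon_auth _ _ _ _ _ H1 ltac:(auto) _ (conv_refl _)) as (v1 & Eh & Hv1 & Hv2 & HR & Hin).
    injection Eh as ->.
    destruct (rel_closed_nil _ _ _ _ HR) as [Hvc _].
    assert (HW : wle W (fst W, s :: snd W)).
    { split; simpl; [|apply incl_tl]; apply incl_refl. }
    exists (fst W, s :: snd W), v2, s2; split; [|split; [|split]]; auto using steps_refl.
    2: { split; [|split; [|split]]; auto. simpl. eapply heaps_mono; [| |exact HH]; auto. apply HW. }
    eapply mrel_pure.
    { eapply psteps_trans.
      { apply (psteps_ctx (IfCtx _ _)); simpl; auto.
        apply psteps_one, PH_BinOp; simpl; auto. }
      simpl. apply psteps_one, PH_If. }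
    destruct (String.eqb_spec (hf s) (hf (ser v1))) as [Eq|Eq]; [|apply mrel_fail].
    (* The one use of collision freedom: the resulting history contains [s], just hashed, and
       [ser v1], present since the hash string was made. *)
    assert (s = ser v1).
    { destruct (string_dec s (ser v1)) as [|N]; auto. exfalso.
      apply (Hcf s (ser v1)); simpl; auto. }
    subst s. eapply mrel_pure; [apply ev_psteps, unauth_accept; auto|].
    + eapply rel_evi_codec; eauto.
    + apply mrel_ret; eauto using rel_mono.
Qed.

(** The stages of [runV] around the execution of a computation. In [run_init] the client may still
    be evaluating to its computation; [run_pure] covers the pure steps between the stages. *)
Inductive run_rel (a : uty) (W : world) : expr -> expr -> Prop :=
| run_init c1 c2 p : rel W [] c1 c2 (uM a) -> run_rel a W (App2 runV c1 (proof_val p)) (App runI c2)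
| run_exec e1 e2 : mrel W e1 e2 a -> run_rel a W (MatchOpt e1 ENone "r" (ESome (Snd (Var "r")))) e2
| run_done v1 v2 : is_val v1 -> rel W [] v1 v2 a -> run_rel a W (ESome v1) v2
| run_fail e2 : run_rel a W ENone e2
| run_pure e1 e1' e2 : psteps e1 e1' -> run_rel a W e1' e2 -> run_rel a W e1 e2.

Lemma sim_run a W e1 e2 : run_rel a W e1 e2 -> forall s1 s2 e1' s1',
  state_rel W s1 s2 -> prim_step hashf e1 s1 e1' s1' -> collision_free hashf s1' ->
  exists W' e2' s2', steps hashf (e2, s2) (e2', s2') /\ run_rel a W' e1' e2' /\ state_rel W' s1' s2'.
Proof.
  induction 1; intros s1 s2 e1'' s1' HS Hs Hcf.
  - destruct (is_val_dec c1) as [Hc|Hc].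
    2: { apply (fill_step_inv hashf (AppLCtx _)) in Hs as (e0 & -> & Hs); simpl; auto;
           [|intros Hv; inversion Hv].
         apply (fill_step_inv hashf (AppRCtx runV)) in Hs as (c1' & -> & Hs); simpl; auto; [|unfold runV; auto].
         destruct (sim_rel _ _ _ _ _ H eq_refl _ _ _ _ HS Hs) as (W' & c2' & s2' & HW & Hst & HR & HS').
         exists W', (App runI c2'), s2'; split; [|split]; auto.
         - apply (steps_ctx (AppRCtx runI)); simpl; auto. unfold runI; auto.
         - apply (run_init a W' c1' c2' p); auto. }
    destruct (rel_closed_nil _ _ _ _ H) as [Hcl1 Hcl2].
    apply (fill_step_inv hashf (AppLCtx _)) in Hs as (e0 & -> & Hs); simpl; auto;
      [|intros Hv; inversion Hv].
    destruct (pstep_det hashf _ _ (pstep_head _ _ (PH_Beta _ _ _ _ Hc)) _ _ _ Hs) as [-> ->].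
    exists W, (App c2 Unit), s2; split; [|split]; auto.
    + apply psteps_steps, psteps_one.
      replace (App c2 Unit) with (subst "" runI (subst "c" c2 (App (Var "c") Unit))) at 1
        by (simpl; eqb_const; rewrite subst_closed; auto).
      constructor. eapply rel_is_val; eauto.
    + simpl. eqb_const. rewrite ?(subst_closed _ _ c1) by auto.
      eapply run_pure; [apply psteps_one, PH_Beta; auto|].
      simpl. eqb_const. rewrite ?(subst_closed _ _ c1), ?(subst_closed _ _ (proof_val p)) by auto using proof_val_closed.
      apply (run_exec a W (App c1 (proof_val p))). eapply mrel_app; eauto. constructor.
  - destruct (is_val_dec e1) as [He|He].
    2: { apply (fill_step_inv hashf (CaseCtx "_" ENone "r" _)) in Hs as (e0 & -> & Hs); simpl; auto.
         destruct (sim_mrel _ _ _ _ H _ _ _ _ HS Hs Hcf) as (W' & e2' & s2' & HW & Hst & HM & HS').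
         exists W', e2', s2'; split; [|split]; auto. apply (run_exec a W' e0 e2'); auto. }
    destruct (mrel_val _ _ _ _ H He) as [->|(p & v1 & -> & Hv & HR)].
    + destruct (pstep_det hashf _ _ (pstep_head _ _ (PH_CaseL Unit "_" ENone "r" _ V_Unit)) _ _ _ Hs) as [-> ->].
      exists W, e2, s2; split; [|split]; auto using steps_refl. apply run_fail.
    + assert (Hp : is_val (Pair (proof_val p) v1)) by auto.
      destruct (pstep_det hashf _ _ (pstep_head _ _ (PH_CaseR _ "_" ENone "r" _ Hp)) _ _ _ Hs) as [-> ->].
      exists W, e2, s2; split; [|split]; auto using steps_refl.
      eapply run_pure; [|apply (run_done a W v1 e2); auto].
      simpl. eqb_const. apply (psteps_ctx InjRCtx); simpl; auto.
      apply psteps_one, PH_Snd; auto.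
  - exfalso; eapply val_no_step; eauto.
  - exfalso; eapply val_no_step; eauto.
  - inversion H as [|e0 ? Hp Hp']; subst; [eauto|].
    destruct (pstep_det hashf _ _ Hp _ _ _ Hs) as [-> ->].
    exists W, e2, s2; split; [|split]; auto using steps_refl.
    eapply run_pure; eauto.
Qed.

Lemma sim_run_steps a c1 c1' : cf_steps hashf c1 c1' -> forall W e2 s2,
  run_rel a W (fst c1) e2 -> state_rel W (snd c1) s2 ->
  exists W' e2' s2', steps hashf (e2, s2) (e2', s2') /\
    run_rel a W' (fst c1') e2' /\ state_rel W' (snd c1') s2'.
Proof.
  induction 1 as [c|c c' c'' [Hs Hcf] _ IH]; intros W e2 s2 HT HS.
  - exists W, e2, s2; auto using steps_refl.
  - destruct (sim_run _ _ _ _ HT _ _ _ _ HS Hs Hcf) as (W' & e2' & s2' & Hst & HT' & HS').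
    destruct (IH _ _ _ HT' HS') as (W'' & e2'' & s2'' & Hst' & ? & ?).
    exists W'', e2'', s2''; split; [|split]; auto. eapply steps_trans; eauto.
Qed.

Lemma run_done_inv a W e1 e2 v : run_rel a W e1 e2 -> is_val v -> e1 = InjR v -> rel W [] v e2 a.
Proof.
  induction 1; intros Hv E; subst; try discriminate.
  - injection E as ->; auto.
  - apply psteps_val in H; auto.
Qed.
End Rel.

Theorem theorem3 (I : Type) (hashf : I -> string -> string) (tau : ty) (e : expr) :
  primitive_ty tau ->
  typed nil nil e (client_ty tau) ->
  forall (p : list string) (i : I) (v : expr) (sigma1 : state I),
    is_val v ->
    cf_steps hashf
      (App2 runV (App (TInst (TInst e)) AuthentikitV) (proof_val p), init_state i)
      (InjR v, sigma1) ->
    exists sigma2 : state I,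
      steps hashf (App runI (App (TInst (TInst e)) AuthentikitI), init_state i) (v, sigma2).
Proof.
  intros Hp Ht p i v sigma1 Hv Hst.
  assert (HR := client_related hashf i ([], []) tau e Hp Ht).
  assert (HS : state_rel hashf i ([], []) (init_state i) (init_state i)).
  { split; [|split; [|split]]; auto. split; [|split]; simpl; try tauto. exists 0; auto. }
  destruct (sim_run_steps hashf i (er tau) _ _ Hst ([], []) _ _ (run_init _ _ _ _ _ _ p HR) HS)
    as (W & e2 & s2 & Hst2 & HT & _).
  apply (run_done_inv _ _ _ _ _ _ v) in HT; auto.
  apply primitive_eq in HT; auto. subst. eauto.
Qed.
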